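(* Let $m\ge3$, $n\ge1$ be integers, $k$ a field with $\mathrm{char}(k)\nmid m!$, $K$ a separable closure of $k$, $G=\mathrm{Gal}(K/k)$, and $P^m_n=X_1^m+\dots+X_n^m$. Let $W=\mu_m^n\rtimes S_n$, $\tilde A=W/\mu_m$ and $p:W\to\tilde A$ the canonical projection. Let $\tilde E$ be the set of projective forms of $P^m_n$ and $\vartheta:\tilde E\hookrightarrow H^1_{\mathrm{cont}}(G,\tilde A)$ the Galois descent map (both defined in the context). (i) $\vartheta$ induces an isomorphism (of pointed sets) $$\tilde E\ \xrightarrow{\ \sim\ }\ \mathrm{Im}\bigl(H^1_{\mathrm{cont}}(G,W)\xrightarrow{p_*}H^1_{\mathrm{cont}}(G,\tilde A)\bigr).$$ (ii) Two classes $(L,x)$ and $(L',x')$ in $H^1_{\mathrm{cont}}(G,W)$ have the same image under $p_*$ if and only if there exists $\lambda\in k^\times$ such that $(L,\lambda x)=(L',x')$ in $H^1_{\mathrm{cont}}(G,W)$. This is equivalent to the existence of a $k$-isomorphism $\psi:L\xrightarrow{\sim}L'$ satisfying $x'\sim_k\psi(x)$. (iii) $\vartheta$ induces an isomorphism of pointed sets $$\tilde E\ \xrightarrow{\ \sim\ }\ \coprod_{[L]}\bigl[\mathrm{Aut}_k(L)\backslash(L^\times/(L^{\times})^m)\bigr]/\sim_k,$$ where $[L]$ runs over the isomorphism classes of commutative separable $k$-algebras of degree $n$. The inverse map sends a pair $(L,x)$ to the isomorphism class of $P^m_n\{L,x\}$.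
   Context: $\mu_m$ is the group of $m$-th roots of unity in $K$; $W=\mu_m^n\rtimes S_n$ is the wreath product, identified with a subgroup of $\mathrm{GL}(n,K)$ via $(\mu_1,\dots,\mu_n)\cdot\sigma\mapsto(\mu_i\delta_{i,\sigma(j)})_{ij}$, with $G$ acting on matrix entries; $\mu_m\subset W$ is embedded diagonally. $H^1_{\mathrm{cont}}$ denotes non-abelian continuous cohomology: classes of continuous maps $s\mapsto a_s$ with $a_{st}=a_s\,{}^s a_t$, modulo $(a_s)\sim(b^{-1}a_s\,{}^sb)$. Category of forms: for a field $F\in\{k,K\}$, let $\widetilde{\mathcal F}_F^{n,m}$ have as objects the non-zero homogeneous polynomials of degree $m$ in $X_1,\dots,X_n$ over $F$, and as morphisms $P\to Q$ the elements $\bar A\in\mathrm{PGL}(n,F)$ represented by $A\in\mathrm{GL}(n,F)$ with $Q(AX)=\lambda P$ for some $\lambda\in F^\times$. $\tilde E$ is the set of objects $Q$ of $\widetilde{\mathcal F}_k^{n,m}$ that become isomorphic to $P^m_n$ in $\widetilde{\mathcal F}_K^{n,m}$, modulo isomorphism in $\widetilde{\mathcal F}_k^{n,m}$. The automorphism group of $P^m_n$ in $\widetilde{\mathcal F}_K^{n,m}$ is $\tilde A\subset\mathrm{PGL}(n,K)$. The injective map $\vartheta$ sends $[Q]$ to the class of $s\mapsto g\cdot{}^s(g^{-1})$, for any isomorphism $g:Q\to P^m_n$ in $\widetilde{\mathcal F}_K^{n,m}$. The classes $(L,x)$: for a commutative separable (étale) $k$-algebra $L$ of degree $n$ and $x\in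 L^\times$, put $N=\mathrm{Hom}_k(L,K)$, choose a bijection $N\cong\{1,\dots,n\}$, identify $W$ with $\mu_m^N\rtimes\mathrm{Aut}(N)$, and let $c_s\in\mathrm{Aut}(N)$ be $\varphi\mapsto s\circ\varphi$. $(L,x)$ denotes the class in $H^1_{\mathrm{cont}}(G,W)$ of the cocycle $s\mapsto\Bigl(\frac{s\sqrt[m]{s^{-1}\varphi x}}{\sqrt[m]{\varphi x}}\Bigr)_{\varphi\in N}\cdot c_s$. By a known theorem (Rupprecht, Brünjes), this yields an isomorphism of pointed sets $\coprod_{[L]}\mathrm{Aut}_k(L)\backslash (L^\times/(L^\times)^m)\to H^1_{\mathrm{cont}}(G,W)$; the base point corresponds to $L=k^n$, $x=1$. The equivalence relation $\sim_k$ on $\mathrm{Aut}_k(L)\backslash(L^\times/(L^\times)^m)$: $[x]\sim_k[x']$ iff there exist $\lambda\in k^\times$, $a\in\mathrm{Aut}_k(L)$, $y\in L^\times$ with $x'=\lambda\cdot a(x)\cdot y^m$. Generalized trace form: with $\{e_1,\dots,e_n\}$ a $k$-basis of $L$, $P^m_n\{L,x\}=\mathrm{Tr}_{L[X_1,\dots,X_n]/k[X_1,\dots,X_n]}\bigl[\frac1x(e_1X_1+\dots+e_nX_n)^m\bigr]$. *)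

(* Defs.v *)
From HB Require Import structures.
From mathcomp Require Import all_boot all_algebra all_field perm.
From mathcomp Require Import generic_quotient boolp.
From mathcomp Require Import mpoly.
From Corelib Require Import RelationClasses.

Set Implicit Arguments.
Unset Strict Implicit.
Unset Printing Implicit Defensive.

Import GRing.Theory.
Local Open Scope ring_scope.
Local Open Scope quotient_scope.

(* A quotient is the type of equivalence classes.  Unlike {eq_quot _}, this   *)
(* needs no choiceType structure on T, which below can be a type of algebras. *)
Section Quotient.
Variables (T : Type) (R : T -> T -> Prop).

Definition quot : Type := {C : T -> Prop | exists x, C = R x}.
Definition cls (x : T) : quot := exist _ (R x) (ex_intro _ x erefl).
Definition rep (q : quot) : T := sval (cid (svalP q)).

Lemma repK q : cls (rep q) = q.
Proof.
by case: q => C hC; apply: eq_exist; rewrite /rep; case: cid => x /= ->.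
Qed.

Lemma cls_eq (eqR : Equivalence R) x y : cls x = cls y <-> R x y.
Proof.
split=> [/(congr1 sval)/= -> | Rxy]; first exact: (Equivalence_Reflexive y).
apply: eq_exist; apply/funext => z; apply/propext; split=> Rz.
  by apply: Equivalence_Transitive (Equivalence_Symmetric _ _ Rxy) _.
exact: Equivalence_Transitive Rxy _.
Qed.

Lemma rep_cls (eqR : Equivalence R) x : R (rep (cls x)) x.
Proof. by apply/cls_eq => //; rewrite repK. Qed.

End Quotient.

Definition separable_closure (k K : fieldType) (iota : {rmorphism k -> K}) : Prop :=
  (forall x : K, exists p : {poly k},
     separable_poly p /\ root (map_poly iota p) x) /\
  (forall p : {poly K}, separable_poly p -> (1 < size p)%N -> exists x, root p x).

Section Galois.
Variables (k K : fieldType) (iota : {rmorphism k -> K}).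

Definition gal : Type :=
  {s : {rmorphism K -> K} | bijective s /\ forall c, s (iota c) = iota c}.

HB.instance Definition _ := gen_eqMixin gal.
HB.instance Definition _ := gen_choiceMixin gal.

Definition gal_fun (s : gal) : {rmorphism K -> K} := sval s.
Coercion gal_fun : gal >-> GRing.RMorphism.type.

Lemma rmorphP (A B : pzRingType) (f g : {rmorphism A -> B}) : f =1 g -> f = g.
Proof.
case: f g => [f [[a] [b]]] [g [[a'] [b']]] /= /funext fg; case: _ / fg a' b' => a' b'.
by congr (GRing.RMorphism.Pack (GRing.RMorphism.Class _ _)); congr (_ _); apply: Prop_irrelevance.
Qed.

Lemma galP (s t : gal) : s =1 t -> s = t.
Proof. by case: s t => [s ?] [t ?] /= /rmorphP st; apply: eq_exist. Qed.

Lemma gal_fix (s : gal) c : s (iota c) = iota c.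
Proof. by case: s => s [? /= ->]. Qed.

Lemma gal_bij (s : gal) : bijective s.
Proof. by case: s => s []. Qed.

Lemma gal_inv_ex (s : gal) : exists t : K -> K, cancel s t /\ cancel t s.
Proof. by case: (gal_bij s) => t st ts; exists t. Qed.

Definition gal_inv_fun (s : gal) : K -> K := sval (cid (gal_inv_ex s)).
Lemma gal_funK (s : gal) : cancel s (gal_inv_fun s).
Proof. by rewrite /gal_inv_fun; case: cid => t []. Qed.
Lemma gal_funVK (s : gal) : cancel (gal_inv_fun s) s.
Proof. by rewrite /gal_inv_fun; case: cid => t []. Qed.

Section Inv.
Variable s : gal.
Fact gal_inv_add : zmod_morphism (gal_inv_fun s).
Proof. exact: can2_zmod_morphism (gal_funK s) (gal_funVK s). Qed.
Fact gal_inv_mon : monoid_morphism (gal_inv_fun s).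
Proof. exact: can2_monoid_morphism (gal_funK s) (gal_funVK s). Qed.
HB.instance Definition _ := GRing.isZmodMorphism.Build K K (gal_inv_fun s) gal_inv_add.
HB.instance Definition _ := GRing.isMonoidMorphism.Build K K (gal_inv_fun s) gal_inv_mon.
End Inv.

Definition gal_one : gal.
Proof. by exists (GRing.RMorphism.clone _ _ (@idfun K) _); split=> //; exists id. Defined.

Definition gal_mul (s t : gal) : gal.
Proof.
exists (GRing.RMorphism.clone _ _ (s \o t) _); split=> [|c] /=.
  exact: bij_comp (gal_bij s) (gal_bij t).
by rewrite !gal_fix.
Defined.

Definition gal_inv (s : gal) : gal.
Proof.
exists (GRing.RMorphism.clone _ _ (gal_inv_fun s) _); split=> [|c] /=.
  exact: Bijective (gal_funVK s) (gal_funK s).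
by rewrite -{1}(gal_fix s c) gal_funK.
Defined.

Fact gal_mulA : associative gal_mul. Proof. by move=> s t u; apply: galP. Qed.
Fact gal_mul1g : left_id gal_one gal_mul. Proof. by move=> s; apply: galP. Qed.
Fact gal_mulg1 : right_id gal_one gal_mul. Proof. by move=> s; apply: galP. Qed.
Fact gal_mulVg : left_inverse gal_one gal_inv gal_mul.
Proof. by move=> s; apply: galP => x; exact: gal_funK. Qed.
Fact gal_mulgV : right_inverse gal_one gal_inv gal_mul.
Proof. by move=> s; apply: galP => x; exact: gal_funVK. Qed.

HB.instance Definition _ :=
  isGroup.Build gal gal_mulA gal_mul1g gal_mulg1 gal_mulVg gal_mulgV.

Lemma galM (s t : gal) x : (s * t : gal)%g x = s (t x). Proof. by []. Qed.
Lemma gal1 x : (1%g : gal) x = x. Proof. by []. Qed.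
Lemma galK (s : gal) : cancel s (s^-1 : gal)%g. Proof. exact: gal_funK. Qed.
Lemma galVK (s : gal) : cancel (s^-1 : gal)%g s. Proof. exact: gal_funVK. Qed.

(* The sets {t | t = s on S}, S finite, are the cosets of the subgroups      *)
(* Gal(K/k(S)), which form a neighbourhood basis of s.                       *)
Definition krull_open (U : gal -> Prop) : Prop :=
  forall s : gal, U s -> exists S : seq K, forall t : gal, {in S, t =1 s} -> U t.

(* Continuity for the discrete topology on the target. *)
Definition krull_continuous (T : Type) (f : gal -> T) : Prop :=
  forall V : T -> Prop, krull_open (fun s => V (f s)).

Lemma krull_continuousP (T : Type) (f : gal -> T) :
  (forall s : gal, exists S : seq K, forall t : gal, {in S, t =1 s} -> f t = f s) ->
  krull_continuous f.
Proof. by move=> fc V s Vs; have [S fS] := fc s; exists S => t /fS ->. Qed.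

End Galois.

(* Non-abelian continuous cohomology of G = Gal(K/k).  A (discrete) G-group is *)
(* given as a G-stable subgroup of an ambient group on which G acts.           *)
Section Cohomology.
Variables (k K : fieldType) (iota : {rmorphism k -> K}).
Local Notation G := (gal iota).

Record Ggroup := MkGgroup {
  ambient : groupType;
  Gact : G -> ambient -> ambient;
  Gmem : ambient -> Prop;
  Gact1 : forall x, Gact 1%g x = x;
  GactM : forall s t x, Gact (s * t)%g x = Gact s (Gact t x);
  Gact_mul : forall s x y, Gact s (x * y)%g = (Gact s x * Gact s y)%g;
  Gmem1 : Gmem 1%g;
  Gmem_mul : forall x y, Gmem x -> Gmem y -> Gmem (x * y)%g;
  Gmem_inv : forall x, Gmem x -> Gmem (x^-1)%g;
  Gmem_act : forall s x, Gmem x -> Gmem (Gact s x) }.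

Section H1.
Variable A : Ggroup.
Local Notation "s ^@ x" := (@Gact A s x) (at level 30).

Record cocycle := MkCocycle {
  cocycle_fun :> G -> ambient A;
  cocycle_mem : forall s, Gmem (cocycle_fun s);
  cocycle_cont : krull_continuous cocycle_fun;
  cocycleM : forall s t, cocycle_fun (s * t)%g = (cocycle_fun s * s ^@ cocycle_fun t)%g }.

Definition cohomologous (a a' : cocycle) : Prop :=
  exists b : ambient A, Gmem b /\ forall s, a' s = (b^-1 * a s * s ^@ b)%g.

Definition H1 : Type := quot cohomologous.

Lemma Gact_1 s : s ^@ 1%g = 1%g.
Proof. by apply: (@mulgI _ (s ^@ 1%g)); rewrite -Gact_mul !mulg1. Qed.

Lemma Gact_inv s x : s ^@ (x^-1)%g = ((s ^@ x)^-1)%g.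
Proof. by apply: (@mulgI _ (s ^@ x)); rewrite -Gact_mul !mulgV Gact_1. Qed.

Lemma cohomologous_equiv : Equivalence cohomologous.
Proof.
split.
- by move=> a; exists 1%g; split=> [|s]; rewrite ?Gact_1 ?invg1 ?mul1g ?mulg1 //; exact: Gmem1.
- move=> a a' [b [hb eb]]; exists (b^-1)%g; split=> [|s]; first exact: Gmem_inv.
  by rewrite eb Gact_inv invgK -!mulgA mulgV mulg1 mulgA mulgV mul1g.
- move=> a a' a'' [b [hb eb]] [c [hc ec]]; exists (b * c)%g; split=> [|s]; first exact: Gmem_mul.
  by rewrite ec eb Gact_mul invgM !mulgA.
Qed.

Definition triv_cocycle : cocycle.
Proof.
exists (fun=> 1%g) => [s||s t]; first exact: Gmem1.
  by apply: krull_continuousP => s; exists [::].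
by rewrite Gact_1 mulg1.
Defined.

Definition H1_base : H1 := cls cohomologous triv_cocycle.

End H1.

Section H1map.
Variables (A B : Ggroup) (f : ambient A -> ambient B).
Hypothesis fM : forall x y, f (x * y)%g = (f x * f y)%g.
Hypothesis fG : forall s x, f (Gact s x) = Gact s (f x).
Hypothesis fmem : forall x, Gmem x -> Gmem (f x).

Definition cocycle_map (a : cocycle A) : cocycle B.
Proof.
exists (f \o a) => [s|V|s t] /=; first exact/fmem/cocycle_mem.
  exact: (@cocycle_cont _ a (fun y => V (f y))).
by rewrite cocycleM fM fG.
Defined.

Definition H1_map (c : H1 A) : H1 B :=
  cls (@cohomologous B) (cocycle_map (rep c)).

Lemma H1_mapE a : H1_map (cls (@cohomologous A) a) = cls (@cohomologous B) (cocycle_map a).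
Proof.
have f1 : f 1%g = 1%g by apply: (@mulgI _ (f 1%g)); rewrite -fM !mulg1.
have fV x : f (x^-1)%g = ((f x)^-1)%g by apply: (@mulgI _ (f x)); rewrite -fM !mulgV.
apply/cls_eq; first exact: cohomologous_equiv.
have [b [hb eb]] := rep_cls (cohomologous_equiv A) a.
by exists (f b); split=> [|s]; [exact: fmem | rewrite /= eb !fM fV fG].
Qed.

End H1map.
End Cohomology.

Section LinearGroups.
Variables (F : fieldType) (n : nat).

Record GL := MkGL { GLmx :> 'M[F]_n; _ : GLmx \in unitmx }.
HB.instance Definition _ := [isSub for GLmx].
HB.instance Definition _ := [Choice of GL by <:].

Lemma GL_unit (A : GL) : (A : 'M_n) \in unitmx. Proof. exact: valP. Qed.

Definition GLone : GL := MkGL (unitmx1 F n).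
Fact GLmul_subproof (A B : GL) : A *m B \in unitmx.
Proof. by rewrite unitmx_mul !GL_unit. Qed.
Definition GLmul (A B : GL) : GL := MkGL (GLmul_subproof A B).
Fact GLinv_subproof (A : GL) : invmx A \in unitmx.
Proof. by rewrite unitmx_inv GL_unit. Qed.
Definition GLinv (A : GL) : GL := MkGL (GLinv_subproof A).

Fact GLmulA : associative GLmul.
Proof. by move=> A B C; apply: val_inj; exact: mulmxA. Qed.
Fact GLmul1g : left_id GLone GLmul.
Proof. by move=> A; apply: val_inj; exact: mul1mx. Qed.
Fact GLmulg1 : right_id GLone GLmul.
Proof. by move=> A; apply: val_inj; exact: mulmx1. Qed.
Fact GLmulVg : left_inverse GLone GLinv GLmul.
Proof. by move=> A; apply: val_inj; exact: mulVmx (GL_unit A). Qed.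
Fact GLmulgV : right_inverse GLone GLinv GLmul.
Proof. by move=> A; apply: val_inj; exact: mulmxV (GL_unit A). Qed.
HB.instance Definition _ := isGroup.Build GL GLmulA GLmul1g GLmulg1 GLmulVg GLmulgV.

Definition proportional (A B : GL) : bool :=
  `[< exists c : F, c != 0 /\ (A : 'M_n) = c *: (B : 'M_n) >].

Fact proportional_equiv : equiv_class_of proportional.
Proof.
split=> [A|A B|B A C].
- by apply/asboolP; exists 1; rewrite oner_eq0 scale1r.
- apply/asboolP/asboolP => -[c [c0 e]]; exists c^-1; rewrite invr_eq0 c0;
  by rewrite e scalerA mulVf ?scale1r.
- move=> /asboolP[c [c0 e]] /asboolP[d [d0 e']]; apply/asboolP.
  by exists (c * d); rewrite mulf_neq0 // e e' scalerA.
Qed.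
Canonical proportional_rel := EquivRelPack proportional_equiv.

Definition PGL := {eq_quot proportional}.
HB.instance Definition _ := Choice.on PGL.
HB.instance Definition _ := EqQuotient.on PGL.

Definition PGL_of (A : GL) : PGL := \pi_PGL A.

Lemma PGL_ofP A B : PGL_of A = PGL_of B <-> exists c : F, c != 0 /\ (A : 'M_n) = c *: (B : 'M_n).
Proof. by split=> [/eqmodP/asboolP|?] //; apply/eqmodP/asboolP. Qed.

Lemma PGL_reprK (g : PGL) : PGL_of (repr g) = g.
Proof. exact: reprK. Qed.

Lemma PGL_repr_of A : exists c : F, c != 0 /\ (repr (PGL_of A) : 'M_n) = c *: (A : 'M_n).
Proof. by apply/PGL_ofP; rewrite PGL_reprK. Qed.

Definition PGLmul (g h : PGL) : PGL := PGL_of (repr g * repr h)%g.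
Definition PGLinv (g : PGL) : PGL := PGL_of ((repr g)^-1)%g.

Lemma PGLmulE A B : PGLmul (PGL_of A) (PGL_of B) = PGL_of (A * B)%g.
Proof.
have [c [c0 ec]] := PGL_repr_of A; have [d [d0 ed]] := PGL_repr_of B.
apply/PGL_ofP; exists (c * d); rewrite mulf_neq0 //; split=> //=.
by rewrite ec ed -scalemxAl -scalemxAr scalerA.
Qed.

Lemma PGLinvE A : PGLinv (PGL_of A) = PGL_of (A^-1)%g.
Proof.
have [c [c0 ec]] := PGL_repr_of A.
apply/PGL_ofP; exists c^-1; rewrite invr_eq0 c0; split=> //=.
by rewrite ec invmxZ // -ec GL_unit.
Qed.

Let ind (P : PGL -> Prop) : (forall A, P (PGL_of A)) -> forall g, P g.
Proof. by move=> h g; rewrite -(PGL_reprK g). Qed.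

Fact PGLmulA : associative PGLmul.
Proof. by elim/ind=> A; elim/ind=> B; elim/ind=> C; rewrite !PGLmulE mulgA. Qed.
Fact PGLmul1g : left_id (PGL_of 1%g) PGLmul.
Proof. by elim/ind=> A; rewrite PGLmulE mul1g. Qed.
Fact PGLmulg1 : right_id (PGL_of 1%g) PGLmul.
Proof. by elim/ind=> A; rewrite PGLmulE mulg1. Qed.
Fact PGLmulVg : left_inverse (PGL_of 1%g) PGLinv PGLmul.
Proof. by elim/ind=> A; rewrite PGLinvE PGLmulE mulVg. Qed.
Fact PGLmulgV : right_inverse (PGL_of 1%g) PGLinv PGLmul.
Proof. by elim/ind=> A; rewrite PGLinvE PGLmulE mulgV. Qed.
HB.instance Definition _ := isGroup.Build PGL PGLmulA PGLmul1g PGLmulg1 PGLmulVg PGLmulgV.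

Lemma PGL_ofM A B : PGL_of (A * B)%g = (PGL_of A * PGL_of B)%g.
Proof. by rewrite -PGLmulE. Qed.
Lemma PGL_ofV A : PGL_of (A^-1)%g = ((PGL_of A)^-1)%g.
Proof. by rewrite -PGLinvE. Qed.
Lemma PGL_of1 : PGL_of 1%g = 1%g. Proof. by []. Qed.

End LinearGroups.

Section GaloisAction.
Variables (k K : fieldType) (iota : {rmorphism k -> K}) (n : nat).
Local Notation G := (gal iota).

Fact GLact_subproof (s : G) (A : GL K n) : map_mx s A \in unitmx.
Proof. by rewrite map_unitmx GL_unit. Qed.
Definition GLact (s : G) (A : GL K n) : GL K n := MkGL (GLact_subproof s A).
Definition PGLact (s : G) (g : PGL K n) : PGL K n := PGL_of (GLact s (repr g)).

Lemma PGLactE s A : PGLact s (PGL_of A) = PGL_of (GLact s A).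
Proof.
have [c [c0 ec]] := PGL_repr_of A.
by apply/PGL_ofP; exists (s c); rewrite fmorph_eq0 c0 /= ec map_mxZ.
Qed.

Lemma GLact1 A : GLact 1%g A = A.
Proof. by apply: val_inj; apply/matrixP=> i j; rewrite /= mxE. Qed.
Lemma GLactM s t A : GLact (s * t)%g A = GLact s (GLact t A).
Proof. by apply: val_inj; apply/matrixP=> i j; rewrite /= !mxE. Qed.
Lemma GLact_mul s A B : GLact s (A * B)%g = (GLact s A * GLact s B)%g.
Proof. by apply: val_inj; rewrite /= map_mxM. Qed.

Lemma PGLact1 g : PGLact 1%g g = g.
Proof. by rewrite -(PGL_reprK g) PGLactE GLact1. Qed.
Lemma PGLactM s t g : PGLact (s * t)%g g = PGLact s (PGLact t g).
Proof. by rewrite -(PGL_reprK g) !PGLactE GLactM. Qed.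
Lemma PGLact_mul s g h : PGLact s (g * h)%g = (PGLact s g * PGLact s h)%g.
Proof.
by rewrite -(PGL_reprK g) -(PGL_reprK h) -PGL_ofM !PGLactE GLact_mul PGL_ofM.
Qed.

Lemma PGLact_1 s : PGLact s 1%g = 1%g.
Proof. by apply: (@mulgI _ (PGLact s 1%g)); rewrite -PGLact_mul !mulg1. Qed.
Lemma PGLact_inv s g : PGLact s (g^-1)%g = ((PGLact s g)^-1)%g.
Proof. by apply: (@mulgI _ (PGLact s g)); rewrite -PGLact_mul !mulgV PGLact_1. Qed.

Lemma PGLact_cont g : krull_continuous (PGLact ^~ g).
Proof.
apply: krull_continuousP => s.
exists [seq (repr g : 'M_n) p.1 p.2 | p : 'I_n * 'I_n] => t ts.
congr PGL_of; apply: val_inj; apply/matrixP=> i j; rewrite /= !mxE.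
by apply: ts; apply/imageP; exists (i, j).
Qed.

End GaloisAction.

Section Forms.
Variables (F : fieldType) (n m : nat).

(* Q(AX) *)
Definition lin_subst (A : 'M[F]_n) (Q : {mpoly F[n]}) : {mpoly F[n]} :=
  Q \mPo [tuple \sum_(j < n) A i j *: 'X_j | i < n].

Record form := MkForm {
  form_poly :> {mpoly F[n]};
  form_neq0 : form_poly != 0;
  form_homog : form_poly \is m.-homog }.

(* Morphisms P -> Q: the classes of the A with Q(AX) = c P. *)
Definition form_morph (P Q : form) (g : PGL F n) : Prop :=
  exists A : GL F n, PGL_of A = g /\
    exists c : F, c != 0 /\ lin_subst A Q = c *: (P : {mpoly F[n]}).

(* Every morphism is invertible (form_morphV below). *)
Definition form_iso (P Q : form) : Prop := exists g, form_morph P Q g.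

Lemma lin_subst1 Q : lin_subst 1%:M Q = Q.
Proof.
rewrite -[RHS]comp_mpoly_id; congr (_ \mPo _); apply: eq_from_tnth => i.
rewrite !tnth_mktuple (bigD1 i) //= mxE eqxx scale1r big1 ?addr0 // => j ji.
by rewrite mxE eq_sym (negPf ji) scale0r.
Qed.

Lemma lin_substM A B Q : lin_subst B (lin_subst A Q) = lin_subst (A *m B) Q.
Proof.
rewrite /lin_subst [Q \mPo _ in LHS]comp_mpolyEX [RHS]comp_mpolyEX [LHS]raddf_sum /=.
apply: eq_bigr => mm _.
rewrite !comp_mpolyZ; congr (_ *: _); rewrite !comp_mpolyX rmorph_prod /=.
apply: eq_bigr => i _; rewrite rmorphXn /= !tnth_mktuple raddf_sum /=.
congr (_ ^+ _); transitivity (\sum_(j < n) \sum_(l < n) (A i j * B j l) *: 'X_l : {mpoly F[n]}).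
  apply: eq_bigr => j _; rewrite comp_mpolyZ comp_mpolyXU -tnth_nth tnth_mktuple scaler_sumr.
  by apply: eq_bigr => l _; rewrite scalerA.
by rewrite exchange_big /=; apply: eq_bigr => j _; rewrite mxE scaler_suml.
Qed.

Lemma lin_substZ A c Q : lin_subst A (c *: Q) = c *: lin_subst A Q.
Proof. exact: comp_mpolyZ. Qed.

Lemma lin_subst_scale_ex A c (Q : form) : c != 0 ->
  exists d, d != 0 /\ lin_subst (c *: A) Q = d *: lin_subst A Q.
Proof.
move=> c0; exists (c ^+ m); rewrite expf_neq0 //; split=> //.
rewrite /lin_subst comp_mpolyEX [in RHS]comp_mpolyEX scaler_sumr.
apply: eq_big_seq => mm Qmm; rewrite !comp_mpolyX scalerA [c ^+ m * _]mulrC -scalerA.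
congr (_ *: _); have /dhomogP/(_ mm Qmm) /= <- := form_homog Q.
rewrite mdegE -prodrXr -scaler_prod; apply: eq_bigr => i _.
rewrite -exprZn; congr (_ ^+ _); rewrite !tnth_mktuple scaler_sumr.
by apply: eq_bigr => j _; rewrite mxE scalerA.
Qed.

Lemma form_morph_of (P Q : form) (A : GL F n) :
  form_morph P Q (PGL_of A) ->
  exists c : F, c != 0 /\ lin_subst A Q = c *: (P : {mpoly F[n]}).
Proof.
case=> B [] /esym/PGL_ofP [c [c0 eA]] [d [d0 eB]].
have [e [e0 he]] := lin_subst_scale_ex B Q c0.
exists (e * d); rewrite mulf_neq0 //; split=> //.
by rewrite eA he eB scalerA.
Qed.

Lemma form_morph1 P : form_morph P P 1%g.
Proof. by exists 1%g; split=> //; exists 1; rewrite oner_eq0 lin_subst1 scale1r. Qed.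

Lemma form_morphM P Q R g h :
  form_morph P Q g -> form_morph Q R h -> form_morph P R (h * g)%g.
Proof.
move=> [A [<- [c [c0 eA]]]] [B [<- [d [d0 eB]]]]; exists (B * A)%g.
rewrite PGL_ofM; split=> //; exists (d * c); rewrite mulf_neq0 //; split=> //.
by rewrite -lin_substM eB lin_substZ eA scalerA.
Qed.

Lemma form_morphV P Q g : form_morph P Q g -> form_morph Q P (g^-1)%g.
Proof.
move=> [A [<- [c [c0 eA]]]]; exists (A^-1)%g; rewrite PGL_ofV; split=> //.
exists c^-1; rewrite invr_eq0 c0; split=> //.
rewrite -[in LHS](scale1r (form_poly P)) -(mulVf c0) -scalerA -eA lin_substZ.
by rewrite lin_substM /= mulmxV ?GL_unit // lin_subst1.
Qed.

Lemma form_iso_equiv : Equivalence form_iso.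
Proof.
split=> [P|P Q [g]|P Q R [g hg] [h hh]]; first by exists 1%g; exact: form_morph1.
  by move=> /form_morphV; exists (g^-1)%g.
by exists (h * g)%g; exact: form_morphM hg hh.
Qed.

End Forms.

Section BaseChange.
Variables (F F' : fieldType) (f : {rmorphism F -> F'}) (n m : nat).

Fact base_change_neq0 (Q : form F n m) : map_mpoly f Q != 0.
Proof.
apply: contraNneq (form_neq0 Q) => e; apply/eqP/mpolyP=> mm.
by apply: (fmorph_inj f); rewrite -mcoeff_map_mpoly e !mcoeff0 rmorph0.
Qed.
Fact base_change_homog (Q : form F n m) : map_mpoly f Q \is m.-homog.
Proof.
apply/dhomogP=> mm; rewrite (perm_mem (msupp_map_mpoly _ (fmorph_inj f))).
by have /dhomogP := form_homog Q; exact.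
Qed.
Definition base_change (Q : form F n m) : form F' n m :=
  MkForm (base_change_neq0 Q) (base_change_homog Q).

Lemma map_lin_subst (A : 'M[F]_n) Q :
  map_mpoly f (lin_subst A Q) = lin_subst (map_mx f A) (map_mpoly f Q).
Proof.
rewrite /lin_subst map_mpoly_comp; last exact: fmorph_inj.
congr (_ \mPo _); apply: eq_from_tnth => i; rewrite tnth_map !tnth_mktuple.
rewrite raddf_sum /=; apply: eq_bigr => j _.
by rewrite map_mpolyZ map_mpolyX mxE.
Qed.

End BaseChange.

Section FermatForm.
Variables (F : fieldType) (n m : nat) (n_gt0 : (0 < n)%N) (m_gt2 : (2 < m)%N).

Definition fermat_poly : {mpoly F[n]} := \sum_(i < n) 'X_i ^+ m.

Fact fermat_neq0 : fermat_poly != 0.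
Proof.
have m0 : (0 < m)%N by case: (m) m_gt2.
pose i0 := Ordinal n_gt0; apply/eqP => /(congr1 (mcoeff (U_(i0) *+ m))).
rewrite mcoeff0 raddf_sum /= (bigD1 i0) //= mpolyXn mcoeffX eqxx big1 ?addr0.
  by move/eqP; rewrite oner_eq0.
move=> j ji; rewrite mpolyXn mcoeffX; case: eqP => // /(congr1 (fun mm : 'X_{1..n} => mm i0)).
rewrite !mulmnE !mnm1E eqxx (negPf ji) mul0n mul1n => e.
by rewrite -e ltnn in m0.
Qed.
Fact fermat_homog : fermat_poly \is m.-homog.
Proof.
apply: rpred_sum => i _; have := dhomogMn m (_ : 'X_i \is [in F[n], 1.-homog]).
by rewrite mul1n; apply; rewrite dhomogX /= mdeg1.
Qed.
Definition fermat : form F n m := MkForm fermat_neq0 fermat_homog.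

End FermatForm.

(* W = mu_m^n x| S_n as a subgroup of GL(n, K). *)
Section Wreath.
Variables (K : fieldType) (n m : nat) (m_gt2 : (2 < m)%N).

Definition wreath_mx (mu : 'I_n -> K) (sigma : 'S_n) : 'M[K]_n :=
  \matrix_(i, j) (mu i * (i == sigma j)%:R).

Definition in_wreath (A : GL K n) : Prop :=
  exists (mu : 'I_n -> K) (sigma : 'S_n),
    (forall i, mu i ^+ m = 1) /\ (A : 'M_n) = wreath_mx mu sigma.

(* The product of permutations composes from left to right. *)
Lemma wreath_mxM mu sigma mu' sigma' :
  wreath_mx mu sigma *m wreath_mx mu' sigma' =
  wreath_mx (fun i => mu i * mu' ((sigma^-1)%g i)) (sigma' * sigma)%g.
Proof.
apply/matrixP=> i j; rewrite !mxE (bigD1 (sigma' j)) //= big1 ?addr0 => [|l lj].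
  rewrite !mxE eqxx mulr1 permM; case: eqP => [->|_]; last by rewrite !mulr0 mul0r.
  by rewrite permK !mulr1.
by rewrite !mxE (negPf lj) !mulr0.
Qed.

Lemma wreath_mx1 : wreath_mx (fun=> 1) 1%g = 1%:M.
Proof. by apply/matrixP=> i j; rewrite !mxE perm1 mul1r. Qed.

Lemma eq_wreath_mx mu mu' sigma : mu =1 mu' -> wreath_mx mu sigma = wreath_mx mu' sigma.
Proof. by move=> e; apply/matrixP=> i j; rewrite !mxE e. Qed.

Lemma in_wreath1 : in_wreath 1%g.
Proof. by exists (fun=> 1), 1%g; split=> [i|]; rewrite ?expr1n ?wreath_mx1. Qed.

Lemma in_wreathM A B : in_wreath A -> in_wreath B -> in_wreath (A * B)%g.
Proof.
move=> [mu [s [hmu eA]]] [mu' [s' [hmu' eB]]].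
exists (fun i => mu i * mu' ((s^-1)%g i)), (s' * s)%g; split=> [i|].
  by rewrite exprMn hmu hmu' mulr1.
by rewrite /= eA eB wreath_mxM.
Qed.

Lemma root1_neq0 (z : K) : z ^+ m = 1 -> z != 0.
Proof.
move=> zm; apply: contra_eq_neq zm => ->; rewrite expr0n.
by case: (m) m_gt2 => //= *; rewrite eq_sym oner_eq0.
Qed.

Lemma in_wreathV A : in_wreath A -> in_wreath (A^-1)%g.
Proof.
move=> [mu [s [hmu eA]]]; exists (fun i => (mu (s i))^-1), (s^-1)%g; split=> [i|].
  by rewrite exprVn hmu invr1.
apply: (can_inj (mulKmx (GL_unit A))); rewrite /= mulmxV ?GL_unit // eA wreath_mxM mulVg.
rewrite -wreath_mx1; apply: eq_wreath_mx => i; rewrite permKV divff //.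
exact: root1_neq0.
Qed.

Lemma map_wreath_mx (s : {rmorphism K -> K}) mu sigma :
  map_mx s (wreath_mx mu sigma) = wreath_mx (s \o mu) sigma.
Proof. by apply/matrixP=> i j; rewrite !mxE rmorphM rmorph_nat. Qed.

Lemma in_wreath_fermat (n_gt0 : (0 < n)%N) (A : GL K n) : in_wreath A ->
  form_morph (fermat K n_gt0 m_gt2) (fermat K n_gt0 m_gt2) (PGL_of A).
Proof.
move=> [mu [s [hmu eA]]]; exists A; split=> //; exists 1; rewrite oner_eq0; split=> //.
rewrite scale1r /= /fermat_poly /lin_subst raddf_sum /= [RHS](reindex_inj (@perm_inj _ (s^-1)%g)) /=.
apply: eq_bigr => i _; rewrite rmorphXn /= comp_mpolyXU -tnth_nth tnth_mktuple eA.
rewrite (bigD1 ((s^-1)%g i)) //= big1 ?addr0 => [|j ji].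
  by rewrite mxE permKV eqxx mulr1 exprZn hmu scale1r.
rewrite mxE; case: eqP => [e|]; last by rewrite mulr0 scale0r.
by rewrite e permK eqxx in ji.
Qed.

End Wreath.

Section ProjectiveForms.
Variables (k K : fieldType) (iota : {rmorphism k -> K}) (n m : nat).
Variables (n_gt0 : (0 < n)%N) (m_gt2 : (2 < m)%N).
Local Notation G := (gal iota).
Local Notation P := (fermat K n_gt0 m_gt2).
Local Notation form_morph := (@form_morph _ n m).

Definition W : Ggroup iota.
Proof.
apply: (@MkGgroup _ _ iota (GL K n) (@GLact _ _ iota n) (@in_wreath K n m)).
- exact: GLact1.
- exact: GLactM.
- exact: GLact_mul.
- exact: in_wreath1.
- exact: in_wreathM.
- exact: in_wreathV.
- move=> s A [mu [sg [hmu eA]]]; exists (s \o mu), sg; split=> [i|] /=.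
    by rewrite -rmorphXn hmu rmorph1.
  by rewrite eA map_wreath_mx.
Defined.

Lemma form_inj (F : fieldType) (Q R : form F n m) : form_poly Q = form_poly R -> Q = R.
Proof. by case: Q R => [Q ? ?] [R ? ?] /= e; subst R; congr MkForm; apply: Prop_irrelevance. Qed.

Lemma base_change_fermat (F F' : fieldType) (f : {rmorphism F -> F'}) :
  base_change f (fermat F n_gt0 m_gt2) = fermat F' n_gt0 m_gt2.
Proof.
apply: form_inj; rewrite /= /fermat_poly raddf_sum /=; apply: eq_bigr => i _.
by rewrite rmorphXn /= map_mpolyX.
Qed.

Lemma base_change_gal (s : G) (Q : form k n m) :
  base_change s (base_change iota Q) = base_change iota Q.
Proof. by apply: form_inj; apply/mpolyP=> mm; rewrite /= !mcoeff_map_mpoly /=; exact: gal_fix. Qed.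

Lemma form_morph_act (s : G) (Q R : form K n m) g : form_morph Q R g ->
  form_morph (base_change s Q) (base_change s R) (PGLact s g).
Proof.
move=> [A [<- [c [c0 e]]]]; exists (GLact s A); rewrite PGLactE; split=> //.
exists (s c); rewrite fmorph_eq0 c0; split=> //.
by rewrite /= -map_lin_subst e map_mpolyZ.
Qed.

(* The automorphism group A~ of P in the category of projective forms over K. *)
Definition Atilde : Ggroup iota.
Proof.
apply: (@MkGgroup _ _ iota (PGL K n) (@PGLact _ _ iota n) (form_morph P P)).
- exact: PGLact1.
- exact: PGLactM.
- exact: PGLact_mul.
- exact: form_morph1.
- by move=> g h hg hh; exact: form_morphM hh hg.
- exact: form_morphV.
- by move=> s g /(form_morph_act s); rewrite base_change_fermat.
Defined.

(* p_*, for p the restriction to W of the projection GL(n, K) -> PGL(n, K). *)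
Definition p_star : H1 W -> H1 Atilde :=
  @H1_map k K iota W Atilde (@PGL_of K n) (@PGL_ofM K n)
    (fun s A => esym (PGLactE s A)) (@in_wreath_fermat K n m m_gt2 n_gt0).

Definition pform : Type :=
  {Q : form k n m | form_iso (base_change iota Q) P}.
Definition pform_iso (Q R : pform) : Prop := form_iso (sval Q) (sval R).
Definition Etilde : Type := quot pform_iso.

Fact pform_fermat_subproof : form_iso (base_change iota (fermat k n_gt0 m_gt2)) P.
Proof. by rewrite base_change_fermat; exists 1%g; exact: form_morph1. Qed.
Definition pform_fermat : pform := exist _ (fermat k n_gt0 m_gt2) pform_fermat_subproof.
Definition Etilde_base : Etilde := cls pform_iso pform_fermat.

Lemma pform_iso_equiv : Equivalence pform_iso.
Proof.
have [r s t] := form_iso_equiv k n m.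
by split=> [Q|Q R|Q R S]; [exact: r | exact: s | exact: t].
Qed.

Section Theta.
Variables (Q : pform) (g : PGL K n).
Hypothesis hg : form_morph (base_change iota (sval Q)) P g.

Definition theta_cocycle : cocycle Atilde.
Proof.
exists (fun s : G => g * PGLact s (g^-1))%g => [s|V s|s t] /=.
- rewrite PGLact_inv; apply: form_morphM hg; apply: form_morphV.
  by have := form_morph_act s hg; rewrite base_change_gal base_change_fermat.
- exact: (@PGLact_cont _ _ iota n (g^-1)%g (fun y => V (g * y)%g)).
- by rewrite PGLact_mul PGLactM !mulgA; congr (_ * _)%g; rewrite -mulgA -PGLact_mul mulVg PGLact_1 mulg1.
Defined.

End Theta.

(* theta [Q] is the class of s |-> g * s(g^-1) for any isomorphism g : Q -> P *)
(* over K (thetaE).                                                          *)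
Definition theta (e : Etilde) : H1 Atilde :=
  cls (@cohomologous _ _ _ Atilde) (theta_cocycle (svalP (cid (svalP (rep e))))).

Lemma thetaE (Q : pform) g (hg : form_morph (base_change iota (sval Q)) P g) :
  theta (cls pform_iso Q) = cls (@cohomologous _ _ _ Atilde) (theta_cocycle hg).
Proof.
apply/cls_eq; first exact: cohomologous_equiv.
have := rep_cls pform_iso_equiv Q; set R := rep _.
case: (cid _) => g1 hg1 /= [_ [A [_ [c [c0 ec]]]]].
have Aunit : map_mx iota A \in unitmx by rewrite map_unitmx GL_unit.
pose h := PGL_of (MkGL Aunit).
have hh : form_morph (base_change iota (sval R)) (base_change iota (sval Q)) h.
  exists (MkGL Aunit); split=> //; exists (iota c); rewrite fmorph_eq0 c0; split=> //=.
  by rewrite -map_lin_subst ec map_mpolyZ.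
have sh s : PGLact (iota := iota) s h = h.
  rewrite PGLactE; congr PGL_of; apply: val_inj; apply/matrixP=> i j.
  by rewrite /= !mxE gal_fix.
exists (g1 * (g * h)^-1)%g; split=> [|s] /=.
  by apply: form_morphM hg1; apply: form_morphV; exact: form_morphM hh hg.
rewrite !PGLact_mul !PGLact_inv !PGLact_mul sh !invgM !invgK.
rewrite !mulgA mulgVK -!mulgA; congr (_ * _)%g.
by rewrite mulKg mulVKg.
Qed.

End ProjectiveForms.

(* Commutative separable algebras: finite products of finite separable field  *)
(* extensions, given by their projections.                                    *)
Section EtaleAlgebras.
Variable k : fieldType.

Definition separable_algebra (L : falgType k) : Prop :=
  exists (r : nat) (E : 'I_r -> fieldExtType k)
         (pr : forall i, {lrmorphism L -> E i}),
    (forall i, separable 1%VS {:E i}%VS) /\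
    (forall y : forall i, E i, exists! x : L, forall i, pr i x = y i).

Record etale (n : nat) := MkEtale {
  etale_alg :> falgType k;
  etale_comm : commutative (@GRing.mul etale_alg);
  etale_dim : \dim {:etale_alg}%VS = n;
  etale_sep : separable_algebra etale_alg }.

End EtaleAlgebras.

(* k^n with componentwise operations. *)
Section SplitAlgebra.
Variables (k : fieldType) (n : nat) (n_gt0 : (0 < n)%N).

Definition split_alg : Type := let _ := n_gt0 in {ffun 'I_n -> k^o}.
HB.instance Definition _ := Vector.copy split_alg {ffun 'I_n -> k^o}.
HB.instance Definition _ := GRing.PzRing.copy split_alg {ffun 'I_n -> k^o}.
Fact split_alg_one_neq0 : 1 != 0 :> split_alg.
Proof. exact: (@ffun1_nonzero 'I_n k (Ordinal n_gt0)). Qed.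
HB.instance Definition _ :=
  GRing.PzSemiRing_isNonZero.Build split_alg split_alg_one_neq0.
Fact split_alg_scaleAl (a : k) (u v : split_alg) : a *: (u * v) = (a *: u) * v.
Proof. by apply/ffunP=> i; rewrite !ffunE -mulrA. Qed.
HB.instance Definition _ :=
  GRing.Lmodule_isLalgebra.Build k split_alg split_alg_scaleAl.
Fact split_alg_scaleAr (a : k) (u v : split_alg) : a *: (u * v) = u * (a *: v).
Proof. by apply/ffunP=> i; rewrite !ffunE; exact: mulrCA. Qed.
HB.instance Definition _ :=
  GRing.Lalgebra_isAlgebra.Build k split_alg split_alg_scaleAr.
HB.instance Definition _ := Algebra_isFalgebra.Build k split_alg.

Section Proj.
Variable i : 'I_n.
Definition split_proj (u : split_alg) : k^o := (u : {ffun 'I_n -> k^o}) i.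
Fact split_proj_linear : linear split_proj.
Proof. by move=> a u v; rewrite /split_proj !ffunE. Qed.
Fact split_proj_monoid : monoid_morphism split_proj.
Proof. by split=> [|u v]; rewrite /split_proj ffunE. Qed.
HB.instance Definition _ :=
  GRing.isLinear.Build k split_alg k^o _ split_proj split_proj_linear.
HB.instance Definition _ :=
  GRing.isMonoidMorphism.Build split_alg k^o split_proj split_proj_monoid.
End Proj.

Fact split_alg_comm : commutative (@GRing.mul split_alg).
Proof. by move=> u v; apply/ffunP=> i; rewrite !ffunE mulrC. Qed.
Fact split_alg_dim : \dim {:split_alg}%VS = n.
Proof. by rewrite dimvf /dim /= card_ord muln1. Qed.
Fact split_alg_sep : separable_algebra split_alg.
Proof.
exists n, (fun=> k^o), (fun i => split_proj i); split=> [i|y].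
  apply/separableP=> x _; apply: base_separable; apply/vlineP; exists x.
  by rewrite -[LHS]mulr1.
exists [ffun i => y i]; split=> [i|u hu]; first by rewrite /= /split_proj ffunE.
by apply/ffunP=> i; rewrite ffunE -hu.
Qed.
Definition split_etale : etale k n :=
  MkEtale split_alg_comm split_alg_dim split_alg_sep.

End SplitAlgebra.

Section Pairs.
Variables (k : fieldType) (n m : nat).

Record etpair := EtPair {
  ep_alg : etale k n;
  ep_elt : ep_alg;
  ep_unit : ep_elt \is a GRing.unit }.

Fact scale_unit (L : etale k n) (x : L) (c : k) :
  c != 0 -> x \is a GRing.unit -> c *: x \is a GRing.unit.
Proof.
move=> c0 ux; apply/unitrP; exists (c^-1 *: x^-1).
by rewrite -!scalerAl -!scalerAr !scalerA mulVf // mulfV // !scale1r mulVr // divrr.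
Qed.

(* The relation [x] ~_k [x'] on Aut_k(L)\(L^* / (L^* )^m). *)
Definition sim_k (L : etale k n) (x x' : L) : Prop :=
  exists (lambda : k) (a : {lrmorphism L -> L}) (y : L),
    [/\ lambda != 0, bijective a, y \is a GRing.unit
      & x' = lambda *: (a x * y ^+ m)].

(* The disjoint union, over the isomorphism classes [L] of separable algebras *)
(* of degree n, of the sets [Aut_k(L)\(L^* / (L^* )^m)] / ~_k: its points are *)
(* the pairs (L, x) modulo transport along isomorphisms L ~ L' and ~_k.       *)
Definition etpair_sim (p p' : etpair) : Prop :=
  exists psi : {lrmorphism ep_alg p -> ep_alg p'},
    bijective psi /\ sim_k (ep_elt p') (psi (ep_elt p)).
Definition etcoprod : Type := quot etpair_sim.

Lemma lrmorph_inv (A B : falgType k) (f : {lrmorphism A -> B}) : bijective f ->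
  exists g : {lrmorphism B -> A}, cancel f g /\ cancel g f.
Proof.
case=> g fg gf.
have g_add : zmod_morphism g := can2_zmod_morphism fg gf.
have g_mon : monoid_morphism g := can2_monoid_morphism fg gf.
have g_scal : scalable g := can2_scalable fg gf.
pose gA := GRing.isZmodMorphism.Build _ _ g g_add.
pose gM := GRing.isMonoidMorphism.Build _ _ g g_mon.
pose gS := GRing.isScalable.Build _ _ _ _ g g_scal.
pose gL : {lrmorphism B -> A} := HB.pack g gA gM gS.
by exists gL.
Qed.

Lemma etpair_sim_equiv : Equivalence etpair_sim.
Proof.
split.
- move=> p; exists idfun; split; first by exists id.
  exists 1, idfun, 1; split; rewrite ?oner_eq0 ?unitr1 //; first by exists id.
  by rewrite expr1n mulr1 scale1r.
- move=> p p' [psi [psi_bij [c [a [y [c0 a_bij uy e]]]]]].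
  have [phi [psiK phiK]] := lrmorph_inv psi_bij.
  exists (phi \o a); split; first by apply: bij_comp a_bij; exists psi.
  exists c^-1, idfun, (phi y^-1); split; rewrite ?invr_eq0 //; first by exists id.
    by rewrite rmorph_unit ?unitrV.
  have -> : ep_elt p = c *: (phi (a (ep_elt p')) * phi y ^+ m).
    by rewrite -rmorphXn -rmorphM -linearZ /= -e psiK.
  rewrite /= -scalerAl scalerA mulVf // scale1r -mulrA -exprMn_comm; last exact: etale_comm.
  by rewrite -rmorphM mulrV // rmorph1 expr1n mulr1.
- move=> p q r [f [f_bij [c [a [y [c0 a_bij uy e]]]]]] [g [g_bij [d [b [z [d0 b_bij uz e']]]]]].
  have [a' [aK a'K]] := lrmorph_inv a_bij.
  exists (g \o (a' \o f)); split.
    by apply: bij_comp g_bij _; apply: bij_comp f_bij; exists a.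
  exists (c * d), b, (z * g (a' y)); split=> //; first by rewrite mulf_neq0.
    by rewrite unitrMl ?rmorph_unit.
  rewrite /= e !linearZ !rmorphM /= aK e' !rmorphXn -scalerAl scalerA.
  by rewrite -mulrA -exprMn_comm //; exact: etale_comm.
Qed.

Definition etpair_base (n_gt0 : (0 < n)%N) : etpair :=
  @EtPair (split_etale k n_gt0) 1 (unitr1 _).

End Pairs.

Section PairClass.
Variables (k K : fieldType) (iota : {rmorphism k -> K}) (n m : nat).
Variables (m_gt2 : (2 < m)%N).
Local Notation G := (gal iota).

Definition hom_k (L : falgType k) : Type :=
  {f : {rmorphism L -> K} | forall c : k, f (c%:A) = iota c}.
Definition hom_fun L (phi : hom_k L) : {rmorphism L -> K} := sval phi.
Coercion hom_fun : hom_k >-> GRing.RMorphism.type.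

Definition hom_act L (s : G) (phi : hom_k L) : hom_k L.
Proof.
exists (GRing.RMorphism.clone _ _ (s \o phi) _) => c /=.
by rewrite (svalP phi) gal_fix.
Defined.

(* nu is the numbering of N = Hom_k(L, K), r the choice of the m-th roots of  *)
(* the phi(x), and sigma the permutation c_s.                                 *)
Definition pair_cocycle (p : etpair k n) (a : cocycle (W iota n m_gt2)) : Prop :=
  exists (nu : 'I_n -> hom_k (ep_alg p)) (r : hom_k (ep_alg p) -> K),
    [/\ bijective nu, forall phi, r phi ^+ m = phi (ep_elt p)
      & forall s : G, exists sigma : 'S_n,
          (forall j, nu (sigma j) = hom_act s (nu j)) /\
          GLmx (a s) = wreath_mx
            (fun i => s (r (hom_act (s^-1)%g (nu i))) / r (nu i)) sigma].

Lemma homP L (phi psi : hom_k L) : phi =1 psi -> phi = psi.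
Proof. by case: phi psi => [f ?] [g ?] /= /rmorphP fg; apply: eq_exist. Qed.

Lemma hom_actM L (s t : G) (phi : hom_k L) :
  hom_act (s * t)%g phi = hom_act s (hom_act t phi).
Proof. exact: homP. Qed.

Lemma hom_actK L (s : G) (phi : hom_k L) : hom_act (s^-1)%g (hom_act s phi) = phi.
Proof. by apply: homP => x; exact: galK. Qed.

Lemma hom_actVK L (s : G) (phi : hom_k L) : hom_act s (hom_act (s^-1)%g phi) = phi.
Proof. by apply: homP => x; exact: galVK. Qed.

Lemma hom_linear L (phi : hom_k L) c x : phi (c *: x) = iota c * phi x.
Proof. by rewrite -mulr_algl rmorphM /= (svalP phi). Qed.

Section Choices.
Variables (p : etpair k n) (nu : 'I_n -> hom_k (ep_alg p)).
Variable r : hom_k (ep_alg p) -> K.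
Hypotheses (nu_bij : bijective nu) (rP : forall phi, r phi ^+ m = phi (ep_elt p)).

Lemma pair_root_neq0 phi : r phi != 0.
Proof.
have m0 : (0 < m)%N by case: (m) m_gt2.
have : phi (ep_elt p) != 0 by rewrite -unitfE rmorph_unit // ep_unit.
by rewrite -rP expf_eq0 m0.
Qed.

Lemma pair_perm_ex (s : G) :
  exists sigma : 'S_n, forall j, nu (sigma j) = hom_act s (nu j).
Proof.
have [mu numu munu] := nu_bij.
have inj : injective (fun j => mu (hom_act s (nu j))).
  move=> i j /(congr1 (hom_act s^-1%g \o nu)) /=.
  by rewrite !munu !hom_actK; exact: can_inj numu _ _.
by exists (perm inj) => j; rewrite permE munu.
Qed.

Definition pair_perm (s : G) : 'S_n := sval (cid (pair_perm_ex s)).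
Lemma pair_permE s j : nu (pair_perm s j) = hom_act s (nu j).
Proof. by rewrite /pair_perm; case: cid => ? /= ->. Qed.
Lemma pair_permVE s i : nu ((pair_perm s)^-1%g i) = hom_act (s^-1)%g (nu i).
Proof.
by rewrite -{2}(permKV (pair_perm s) i) pair_permE hom_actK.
Qed.

Definition pair_coef (s : G) (i : 'I_n) : K :=
  s (r (hom_act (s^-1)%g (nu i))) / r (nu i).

Lemma pair_coef_root s i : pair_coef s i ^+ m = 1.
Proof.
rewrite exprMn exprVn -rmorphXn !rP /= galVK divff //.
by rewrite -rP expf_neq0 // pair_root_neq0.
Qed.

Fact pair_mx_unit s : wreath_mx (pair_coef s) (pair_perm s) \in unitmx.
Proof.
suff /mulmx1_unit[] : wreath_mx (pair_coef s) (pair_perm s) *m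
  wreath_mx (fun i => (pair_coef s (pair_perm s i))^-1) ((pair_perm s)^-1)%g = 1%:M by [].
rewrite wreath_mxM mulVg -wreath_mx1; apply: eq_wreath_mx => i.
by rewrite permKV divff // (root1_neq0 m_gt2) // pair_coef_root.
Qed.

Lemma eq_pair_mx (s t : G) :
  {in [seq r (nu i) | i : 'I_n] ++
      [seq nu ij.1 ((vbasis {:ep_alg p})`_ij.2) | ij : 'I_n * 'I_(\dim {:ep_alg p})],
      t =1 s} ->
  MkGL (pair_mx_unit t) = MkGL (pair_mx_unit s).
Proof.
move=> ts; have act_ts (phi : hom_k (ep_alg p)) : hom_act t phi = hom_act s phi.
  have [mu _ munu] := nu_bij; rewrite -(munu phi); set i := mu phi.
  apply: homP => x; rewrite (coord_vbasis (memvf x)) /= !raddf_sum /=.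
  apply: eq_bigr => j _; rewrite hom_linear !rmorphM /= !gal_fix; congr (_ * _).
  by apply: ts; rewrite mem_cat; apply/orP; right; apply/imageP; exists (i, j).
have actV_ts (phi : hom_k (ep_alg p)) : hom_act t^-1%g phi = hom_act s^-1%g phi.
  by rewrite -{1}(hom_actVK s phi) -act_ts hom_actK.
have perm_ts : pair_perm t = pair_perm s.
  apply/permP => j; apply: (bij_inj nu_bij).
  by rewrite !pair_permE act_ts.
apply: val_inj; rewrite /= perm_ts; apply: eq_wreath_mx => i.
rewrite /pair_coef actV_ts; congr (_ / _); apply: ts; rewrite mem_cat.
have [mu _ munu] := nu_bij; rewrite -(munu (hom_act _ _)).
by apply/orP; left; apply/imageP; eexists.
Qed.

Definition pair_cocycle_of : cocycle (W iota n m_gt2).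
Proof.
exists (fun s => MkGL (pair_mx_unit s)) => [s||s t] /=.
- by exists (pair_coef s), (pair_perm s); split=> // i; exact: pair_coef_root.
- by apply: krull_continuousP => s; eexists => t; exact: eq_pair_mx.
apply: val_inj; rewrite /= map_wreath_mx wreath_mxM.
have -> : pair_perm (s * t)%g = (pair_perm t * pair_perm s)%g.
  apply/permP=> j; apply: (bij_inj nu_bij).
  by rewrite permM !pair_permE hom_actM.
apply: eq_wreath_mx => i; rewrite /= /pair_coef pair_permVE.
rewrite fmorph_div invgM hom_actM /=.
by rewrite [RHS]mulrC mulrA divfK // fmorph_eq0 pair_root_neq0.
Defined.

Lemma pair_cocycle_ofP : pair_cocycle p pair_cocycle_of.
Proof.
by exists nu, r; split=> // s; exists (pair_perm s); split=> // j; exact: pair_permE.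
Qed.

End Choices.

(* The class does not depend on the choices. *)
Lemma pair_cocycle_cohomologous p a a' :
  pair_cocycle p a -> pair_cocycle p a' -> cohomologous a a'.
Proof.
move=> [nu [r [nu_bij rP aP]]] [nu' [r' [nu'_bij r'P a'P]]].
have [mu numu munu] := nu_bij.
have inj : injective (mu \o nu').
  by apply: inj_comp (bij_inj nu'_bij); exact: can_inj munu.
pose tau := perm inj.
have tauE j : nu (tau j) = nu' j by rewrite permE /= munu.
have tauVE i : nu' (tau^-1%g i) = nu i by rewrite -tauE permKV.
pose beta i := r' (nu i) / r (nu i).
have r0 := pair_root_neq0 rP; have r0' := pair_root_neq0 r'P.
have beta1 i : beta i ^+ m = 1.
  by rewrite exprMn exprVn rP r'P divff // -rP expf_neq0.
have b_unit : wreath_mx beta tau \in unitmx.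
  suff /mulmx1_unit[] : wreath_mx beta tau *m
    wreath_mx (fun i => (beta (tau i))^-1) (tau^-1)%g = 1%:M by [].
  rewrite wreath_mxM mulVg -wreath_mx1; apply: eq_wreath_mx => i.
  by rewrite permKV divff // (root1_neq0 m_gt2).
exists (MkGL b_unit); split; first by exists beta, tau.
move=> s; rewrite -mulgA; apply: (canRL (mulKg _)); apply: val_inj => /=.
have [sg [sgP ->]] := aP s; have [sg' [sg'P ->]] := a'P s.
rewrite map_wreath_mx !wreath_mxM.
have -> : (sg' * tau)%g = (tau * sg)%g.
  apply/permP=> j; apply: (bij_inj nu_bij).
  by rewrite !permM tauE sg'P sgP tauE.
apply: eq_wreath_mx => i; rewrite tauVE /= /beta.
have -> : nu (sg^-1%g i) = hom_act (s^-1)%g (nu i).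
  by rewrite -{2}(permKV sg i) sgP hom_actK.
rewrite fmorph_div; set u := hom_act _ _.
have := fmorph_eq0 s (r u); rewrite (negPf (r0 u)) => /negbT su.
by rewrite [LHS]mulrC mulrA divfK // [RHS]mulrC mulrA divfK.
Qed.

(* The default value is never used: see pair_cocycle_ex and pair_classE. *)
Definition pair_class (p : etpair k n) : H1 (W iota n m_gt2) :=
  if pselect (exists a, pair_cocycle p a) is left ex_a
  then cls (@cohomologous _ _ _ (W iota n m_gt2)) (sval (cid ex_a))
  else H1_base _.

Lemma pair_classE p a : pair_cocycle p a ->
  pair_class p = cls (@cohomologous _ _ _ (W iota n m_gt2)) a.
Proof.
move=> pa; rewrite /pair_class; case: pselect => [ex_a|[]]; last by exists a.
case: cid => a' pa' /=; apply/cls_eq; first exact: cohomologous_equiv.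
exact: pair_cocycle_cohomologous pa' pa.
Qed.

End PairClass.

(* Under the standing assumptions every pair (L, x) has a cocycle. *)
Section Existence.
Variables (k K : fieldType) (iota : {rmorphism k -> K}).
Hypothesis hK : separable_closure iota.

Lemma sep_closed_roots (p : {poly K}) : separable_poly p ->
  exists rs : seq K, [/\ size rs = (size p).-1, uniq rs & forall x, root p x = (x \in rs)].
Proof.
elim: {p}(size p) {-2}p (erefl (size p)) => [|d IH] p hd sp.
  by have := separable_poly_neq0 sp; rewrite -size_poly_eq0 hd.
case: d IH hd => [|d] IH hd.
  have /size_poly1P[c c0 ->] : size p == 1 by rewrite hd.
  by exists [::]; rewrite size_polyC c0; split=> // x; rewrite rootC in_nil (negPf c0).
have [|x rx] := hK.2 p sp; first by rewrite hd.
have /factor_theorem[q eq] := rx; move: sp; rewrite eq separable_mul => /and3P[sq _ cq].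
have q0 : q != 0 by exact: separable_poly_neq0.
have sqd : size q = d.+1.
  by move: hd; rewrite eq size_Mmonic ?monicXsubC // size_XsubC addn2 => -[].
have [rs [srs urs rsP]] := IH q sqd sq.
exists (x :: rs); rewrite -eq hd /= srs sqd; split=> //; last first.
  by move=> y; rewrite eq rootM root_XsubC rsP inE orbC.
by rewrite urs andbT -rsP -coprimep_XsubC.
Qed.

Section Field.
Variable E : fieldExtType k.
Hypothesis sepE : separable 1%VS {:E}%VS.

Let z : E := separable_generator 1 {:E}.
Let zP : {:E}%VS = <<1; z>>%VS.
Proof. by apply: (@eq_adjoin_separable_generator _ _ {:E}%AS 1%AS) => //; exact: sub1v. Qed.

Let q_ex : exists q : {poly k}, minPoly 1 z = map_poly (in_alg E) q.
Proof. exact/polyOver1P/(minPolyOver 1%AS z). Qed.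
Let q := sval (cid q_ex).
Let qE : minPoly 1 z = map_poly (in_alg E) q.
Proof. exact: (svalP (cid q_ex)). Qed.

Let q_sep : separable_poly (map_poly iota q).
Proof.
rewrite separable_map -(separable_map (in_alg E)) -qE.
exact: separable_generatorP.
Qed.

Let size_q : size q = (\dim {:E}).+1.
Proof.
rewrite -(size_map_poly (in_alg E)) -qE (size_minPoly 1%AS z); congr _.+1.
by rewrite zP (dim_Fadjoin 1%AS) dimv1 muln1.
Qed.

Let ev_ex (y : E) : exists p : {poly k}, y = (map_poly (in_alg E) p).[z].
Proof.
have /(@Fadjoin_polyP _ _ 1%AS)[p /polyOver1P[p' ->] ->] : y \in <<1; z>>%VS by rewrite -zP memvf.
by exists p'.
Qed.
Let ev y := sval (cid (ev_ex y)).
Let evE y : y = (map_poly (in_alg E) (ev y)).[z].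
Proof. exact: (svalP (cid (ev_ex y))). Qed.

Section Root.
Variable x : K.
Hypothesis xP : root (map_poly iota q) x.

Let f (y : E) : K := (map_poly iota (ev y)).[x].

Let fE p : f (map_poly (in_alg E) p).[z] = (map_poly iota p).[x].
Proof.
rewrite /f; set p' := ev _; apply/eqP; rewrite -subr_eq0 -hornerN -hornerD -rmorphB /=.
have : q %| p' - p.
  rewrite -(dvdp_map (in_alg E)) -qE; apply: (minPoly_dvdp (K := 1%AS)).
    by apply/polyOver1P; exists (p' - p).
  by rewrite rootE rmorphB hornerD hornerN -evE subrr.
by rewrite -(dvdp_map iota) => /dvdpP[u ->]; rewrite hornerM (rootP xP) mulr0.
Qed.

Fact root_hom_add : zmod_morphism f.
Proof.
move=> y y'; rewrite {1}(evE y) {1}(evE y') -hornerN -hornerD -rmorphB /= fE.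
by rewrite rmorphB hornerD hornerN.
Qed.
Fact root_hom_mon : monoid_morphism f.
Proof.
split=> [|y y']; first by have := fE 1; rewrite !rmorph1 !hornerE.
by rewrite {1}(evE y) {1}(evE y') -hornerM -rmorphM /= fE rmorphM hornerM.
Qed.
HB.instance Definition _ := GRing.isZmodMorphism.Build E K f root_hom_add.
HB.instance Definition _ := GRing.isMonoidMorphism.Build E K f root_hom_mon.

Lemma root_hom_ex : exists phi : hom_k iota E, phi z = x.
Proof.
have fk c : f c%:A = iota c.
  by have := fE c%:P; rewrite !map_polyC !hornerC.
exists (exist (fun f : {rmorphism E -> K} => forall c, f c%:A = iota c) (GRing.RMorphism.clone _ _ f _) fk).
by have := fE 'X; rewrite !map_polyX !hornerX.
Qed.
End Root.

Let hom_root (phi : hom_k iota E) p :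
  phi (map_poly (in_alg E) p).[z] = (map_poly iota p).[phi z].
Proof.
rewrite -horner_map -map_poly_comp; congr (_.[_]).
by apply: eq_map_poly => c /=; rewrite (svalP phi).
Qed.

Lemma field_homs : exists nu : 'I_(\dim {:E}) -> hom_k iota E, bijective nu.
Proof.
have [rs [srs urs rsP]] := sep_closed_roots q_sep.
rewrite size_map_poly size_q /= in srs.
have rsx (j : 'I_(\dim {:E})) : root (map_poly iota q) rs`_j.
  by rewrite rsP mem_nth // srs.
pose nu j := sval (cid (root_hom_ex (rsx j))).
have nuE j : nu j z = rs`_j by exact: (svalP (cid (root_hom_ex (rsx j)))).
have qz (phi : hom_k iota E) : phi z \in rs.
  by rewrite -rsP rootE -hom_root -qE minPolyxx rmorph0.
have idx (phi : hom_k iota E) : (index (phi z) rs < \dim {:E})%N by rewrite -srs index_mem.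
exists nu; exists (fun phi => Ordinal (idx phi)) => [j|phi].
  by apply: val_inj; rewrite /= nuE index_uniq // srs.
apply: homP => y; rewrite (evE y) !hom_root nuE /= nth_index //.
Qed.

End Field.

Section Algebra.
Variable L : falgType k.
Hypothesis sepL : separable_algebra L.

Lemma separable_homs : exists nu : 'I_(\dim {:L}) -> hom_k iota L, bijective nu.
Proof.
have [r [E [pr [sepE prP]]]] := sepL.
pose d i := \dim {:E i}.
pose T := {i : 'I_r & 'I_(d i)}.
have nuE_ex i : exists nu : 'I_(d i) -> hom_k iota (E i), bijective nu.
  exact: field_homs (sepE i).
pose nuE i := sval (cid (nuE_ex i)).
have nuE_bij i : bijective (nuE i) by exact: (svalP (cid (nuE_ex i))).
have pr_inj x y : (forall i, pr i x = pr i y) -> x = y.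
  move=> xy; have [u [_ uU]] := prP (fun i => pr i y).
  by rewrite -(uU x xy) -(uU y).
have pr_surj (y : forall i, E i) : exists x, forall i, pr i x = y i.
  by have [x []] := prP y; exists x.
have cardT : #|{: T}| = \dim {:L}.
  pose F (x : L) : {ffun T -> k^o} :=
    [ffun t => coord (vbasis {:E (tag t)}) (tagged t) (pr (tag t) x)].
  have F_lin : linear F.
    by move=> c x y; apply/ffunP=> t; rewrite !ffunE !linearP.
  pose Fl := GRing.isLinear.Build _ _ _ _ F F_lin.
  pose FL : {linear L -> {ffun T -> k^o}} := HB.pack F Fl.
  pose phi := linfun FL.
  have phiE x : phi x = F x by rewrite lfunE.
  have ker0 : (lker phi == 0)%VS.
    apply/lker0P=> x y; rewrite !phiE => /ffunP xy; apply: pr_inj => i.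
    rewrite (coord_vbasis (memvf (pr i x))) (coord_vbasis (memvf (pr i y))).
    by apply: eq_bigr => j _; have := xy (Tagged (fun i => 'I_(d i)) j); rewrite !ffunE /= => ->.
  have im : limg phi = fullv.
    apply/vspaceP => u; rewrite memvf.
    pose y i : E i := \sum_(j < d i) u (Tagged (fun i => 'I_(d i)) j) *: (vbasis {:E i})`_j.
    have [x xP] := pr_surj y.
    suff -> : u = phi x by rewrite memv_img ?memvf.
    apply/ffunP=> -[i j]; rewrite phiE ffunE /= xP /y coord_sum_free //.
    exact: basis_free (vbasisP _).
  have : \dim (limg phi) = \dim {:L}.
    by apply: limg_dim_eq; apply/eqP; rewrite capfv.
  by rewrite im dimvf /dim /= muln1.
pose e (i : 'I_r) : L := sval (cid (pr_surj (fun j => (j == i)%:R))).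
have eE i j : pr j (e i) = (j == i)%:R by exact: (svalP (cid (pr_surj (fun j => (j == i)%:R)))).
pose nuTm (t : T) : {rmorphism L -> K} :=
  GRing.RMorphism.clone _ _ (nuE (tag t) (tagged t) \o pr (tag t)) _.
have nuTk t c : nuTm t c%:A = iota c by rewrite /= rmorph_alg (svalP (nuE _ _)).
pose nuT t : hom_k iota L := exist _ (nuTm t) (nuTk t).
have nuTE t x : nuT t x = nuE (tag t) (tagged t) (pr (tag t) x) by [].
have li i y : exists x, pr i x = y.
  have [x xP] := pr_surj (fun l => if @eqP _ i l is ReflectT h then ecast l (E l) h y else 0).
  by exists x; rewrite xP; case: eqP => // h; rewrite eq_axiomK.
have nuT_inj : injective nuT.
  move=> [i j] [i' j'] ij.
  have ii' : i' = i.
    have := nuTE (existT _ i j) (e i); rewrite ij nuTE /= !eE eqxx rmorph1 rmorph_nat.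
    by case: eqP => //= _ /eqP; rewrite eq_sym oner_eq0.
  subst i'; suff -> : j = j' by []; apply: (bij_inj (nuE_bij i)).
  apply: homP => y; have [x prx] := li i y.
  by rewrite -prx -(nuTE (existT _ i j)) ij.
have nuT_surj phi : exists t, nuT t = phi.
  have sum1 : \sum_i e i = 1.
    apply: pr_inj => j; rewrite rmorph1 rmorph_sum /= (bigD1 j) //= eE eqxx big1 ?addr0 // => i ij.
    by rewrite eE eq_sym (negPf ij).
  have [i phii] : exists i, phi (e i) != 0.
    apply: contrapT => /forallNP h; have /eqP := oner_neq0 K; apply.
    rewrite -(rmorph1 phi) -sum1 rmorph_sum big1 // => i _.
    by have := h i; case: eqP.
  have ei2 : e i * e i = e i.
    by apply: pr_inj => j; rewrite rmorphM /= !eE; case: eqP => _; rewrite ?mulr1 ?mulr0.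
  have phi1 : phi (e i) = 1 by apply: (mulfI phii); rewrite -rmorphM ei2 mulr1.
  have phiP x y : pr i x = pr i y -> phi x = phi y.
    move=> xy; rewrite -[LHS]mulr1 -[RHS]mulr1 -phi1 -!rmorphM; congr (phi _).
    apply: pr_inj => j; rewrite !rmorphM /= !eE; case: eqP => [->|_]; last by rewrite !mulr0.
    by rewrite xy.
  pose g y := phi (sval (cid (li i y))).
  have gE x : g (pr i x) = phi x by apply: phiP; exact: (svalP (cid (li i _))).
  have g_add : zmod_morphism g.
    by move=> y y'; have [x <-] := li i y; have [x' <-] := li i y'; rewrite -rmorphB !gE rmorphB.
  have g_mon : monoid_morphism g.
    split=> [|y y']; first by rewrite -(rmorph1 (pr i)) gE rmorph1.
    by have [x <-] := li i y; have [x' <-] := li i y'; rewrite -rmorphM !gE rmorphM.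
  pose gA := GRing.isZmodMorphism.Build _ _ g g_add.
  pose gM := GRing.isMonoidMorphism.Build _ _ g g_mon.
  pose gR : {rmorphism E i -> K} := HB.pack g gA gM.
  have gk c : gR c%:A = iota c.
    by rewrite -(rmorph_alg (pr i)) /= gE (svalP phi).
  have [j jP] : exists j, nuE i j = exist _ gR gk.
    by have [mu _ h] := nuE_bij i; exists (mu (exist _ gR gk)).
  exists (existT _ i j); apply: homP => x.
  by rewrite nuTE /= jP /= gE.
rewrite -cardT; exists (nuT \o enum_val).
apply: bij_comp; last exact: enum_val_bij.
pose mu phi := sval (cid (nuT_surj phi)).
have munu phi : nuT (mu phi) = phi by exact: (svalP (cid (nuT_surj phi))).
by exists mu => // t; apply: nuT_inj.
Qed.

End Algebra.

Variables (n m : nat) (m_gt2 : (2 < m)%N).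
Hypothesis hchar : forall p : nat, p \in [pchar k] -> ~~ (p %| m`!)%N.

Lemma char_natr_neq0 : m%:R != 0 :> k.
Proof.
have m0 : (0 < m)%N by case: (m) m_gt2.
apply/negP => h; have [p hp] := natf0_pchar m0 h; have := hchar hp.
have pm : (p %| m)%N by rewrite (dvdn_pcharf hp).
by rewrite (dvdn_trans pm) // dvdn_fact // m0 leqnn.
Qed.

Lemma root_ex (c : K) : c != 0 -> exists y, y ^+ m = c.
Proof.
move=> c0; have m0 : (0 < m)%N by case: (m) m_gt2.
have mK : m%:R != 0 :> K by rewrite -(rmorph_nat iota) fmorph_eq0 char_natr_neq0.
have sz : size ('X^m - c%:P) = m.+1 by rewrite size_XnsubC.
have [||y] := hK.2 ('X^m - c%:P).
- rewrite unlock; apply/Bezout_coprimepP; exists (- m%:R%:P, 'X) => /=.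
  have -> : - m%:R%:P * ('X^m - c%:P) + 'X * ('X^m - c%:P)^`() = (m%:R * c)%:P.
    rewrite derivB derivC subr0 derivXn mulrnAr -exprS prednK // mulNr mulrBr opprB.
    by rewrite polyCM polyC_natr -[X in _ + X]mulr_natl subrK.
  by rewrite polyC_eqp1 mulf_neq0.
- by rewrite sz ltnS.
by rewrite rootE !hornerE subr_eq0 => /eqP; exists y.
Qed.

Lemma pair_cocycle_ex (p : etpair k n) : exists a, @pair_cocycle k K iota n m m_gt2 p a.
Proof.
have := separable_homs (etale_sep (ep_alg p)); rewrite etale_dim => -[nu nu_bij].
have r_ex (phi : hom_k iota (ep_alg p)) : exists y, y ^+ m = phi (ep_elt p).
  by apply: root_ex; rewrite -unitfE rmorph_unit // ep_unit.
pose r phi := sval (cid (r_ex phi)).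
have rP phi : r phi ^+ m = phi (ep_elt p) by exact: (svalP (cid (r_ex phi))).
by exists (pair_cocycle_of m_gt2 nu_bij rP); exact: pair_cocycle_ofP.
Qed.

End Existence.

Section TraceForm.
Variables (k : fieldType) (n m : nat) (L : etale k n) (e : n.-tuple L).

(* The matrix, in the basis e of the free k[X]-module L[X], of multiplication *)
(* by f: its j-th column holds the coordinates of f * e_j.                    *)
Definition mul_poly_mx (f : {mpoly L[n]}) : 'M[{mpoly k[n]}]_n :=
  \matrix_(i, j) map_mpoly (fun a => coord e i (a * e`_j)) f.

Lemma mul_poly_mxP (f : {mpoly L[n]}) (j : 'I_n) : basis_of fullv e ->
  (e`_j)%:MP * f = \sum_(i < n) (e`_i)%:MP * map_mpoly (in_alg L) (mul_poly_mx f i j).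
Proof.
move=> he; apply/mpolyP=> mm; rewrite mcoeffCM etale_comm raddf_sum /=.
rewrite [LHS](coord_basis he) ?memvf //; apply: eq_bigr => i _.
have addc : zmod_morphism (fun a => coord e i (a * e`_j)).
  by move=> a b; rewrite mulrBl linearB.
pose cA := GRing.isZmodMorphism.Build _ _ (fun a => coord e i (a * e`_j)) addc.
pose c : {additive L -> k} := HB.pack (fun a => coord e i (a * e`_j)) cA.
by rewrite mcoeffCM mcoeff_map_mpoly mxE (mcoeff_map_mpoly c) /= mulr_algr.
Qed.

Definition poly_trace (f : {mpoly L[n]}) : {mpoly k[n]} := \tr (mul_poly_mx f).

Definition trace_form (x : L) : {mpoly k[n]} :=
  poly_trace (x^-1 *: (\sum_(j < n) e`_j *: 'X_j) ^+ m).

End TraceForm.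

(* Main.v *)
(* A form Q that becomes projectively isomorphic to P = P^m_n over K can be   *)
(* written Q = P(AX), and s |-> A s(A)^-1 is then a cocycle with values in    *)
(* the stabiliser of P in GL(n, K), which is W: applying d_l d_j (j != l) to  *)
(* P(BX) = P and substituting B^-1 X kills every product B_ij B_il.  So every *)
(* class of projective forms lifts to W.  Conversely, by Hilbert 90 for GL_n  *)
(* a W-cocycle (mu_s, sigma_s) is A s(A)^-1.  Its permutation part gives the  *)
(* etale algebra L of equivariant families, and the inverses r_i of the       *)
(* entries A_(i, c(i)), with c constant on orbits, satisfy mu_s(i) =          *)
(* s(r_(s^-1 i))/r_i, so that the family r_i^m is an element x of L and the   *)
(* cocycle is that of (L, x).  For such a pair one may take A_(i, j) =        *)
(* phi_i(e_j) / r_i, and then P(AX) is the trace form P{L, x}.  Finally, if   *)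
(* the cocycles a = A s(A)^-1 and a' = A' s(A')^-1 of two pairs are           *)
(* cohomologous in PGL through b in W, then D = A'^-1 b^-1 A satisfies s(D) = *)
(* (s(d)/d) D for any entry d != 0 of D, and lambda = d^m is the required     *)
(* scalar.                                                                    *)

From HB Require Import structures.
From mathcomp Require Import all_boot all_algebra all_field perm.
From mathcomp Require Import generic_quotient boolp mpoly ring.
From mathcomp Require classical_sets.
Require Import Defs.

Set Implicit Arguments.
Unset Strict Implicit.
Unset Printing Implicit Defensive.

Import GRing.Theory.
Local Open Scope ring_scope.

(** * Extending partial isomorphisms to the Galois group *)

(** The stabiliser of P in GL(n, K) is exactly W ([fermat_stabilizer]), and K contains the m-th
    roots needed to absorb the scalar of an isomorphism of projective forms. Descent data with
    values in A~ coming from a form therefore lift to W ([theta_lifts]). Injectivity of theta holds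
    because a Galois-invariant class in PGL(n, K) has a representative over k ([theta_injective]).

    A cocycle in W has two layers. Its permutation part is a Galois action on n points, which is the
    same thing as an etale algebra ([etale_of_perm], [equivariant_iso]); its mu_m part is Kummer
    theory over that algebra ([pair_class_surjective], [pair_class_eqP]). Inside GL(n, K) the
    cocycle of (L, x) is split by the matrix phi_i(e_j) / r_i, and the same matrix carries P to the
    trace form ([map_trace_form]). Hence theta sends the trace form of (L, x) to the image of (L, x)
    under p_* ([theta_trace_form]), which gives surjectivity onto the image of p_* and the inverse
    map.

    Two pairs with the same image under p_* have W-cocycles that agree, up to coboundary, after
    multiplication by scalars s(d)/d. These scalars are m-th roots of unity, so d^m lies in k and
    accounts for lambda ([p_star_pair_classP]).

    All this rests on the Galois theory of K/k: embeddings extend to K by Zorn's lemma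
    ([partial_iso_extends_to_gal]), the fixed field is k ([gal_fixed]), and Hilbert 90 holds for
    GL_n ([hilbert90]). *)

Section SubfieldType.
Variables (K : fieldType) (D : divringClosed K).

(** Turning a subfield given by a predicate into a field type makes it possible to speak of
    polynomials over the domain of a partial isomorphism. *)
Record subfield_type := Subfield { subfield_val : K; _ : subfield_val \in D }.
HB.instance Definition _ := [isSub for subfield_val].
HB.instance Definition _ := [Choice of subfield_type by <:].
HB.instance Definition _ := [SubChoice_isSubComUnitRing of subfield_type by <:].
HB.instance Definition _ := [SubComUnitRing_isSubIntegralDomain of subfield_type by <:].
HB.instance Definition _ := [SubIntegralDomain_isSubField of subfield_type by <:].

End SubfieldType.

(** Among the nonzero polynomials vanishing at [x], one of least size is irreducible. *)
Lemma irreducible_root_poly (F K : fieldType) (f : {rmorphism F -> K}) (x : K) (p1 : {poly F}) :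
  p1 != 0 -> root (map_poly f p1) x ->
  exists p, [/\ p != 0, irreducible_poly p & root (map_poly f p) x].
Proof.
move=> p1_neq0 p1x.
pose P d := `[< exists p : {poly F}, [/\ p != 0, root (map_poly f p) x & size p = d] >].
have exP : exists d, P d by exists (size p1); apply/asboolP; exists p1.
have [d /asboolP[p [p_neq0 px <-]] minp] := ex_minnP exP.
exists p; split=> //; apply/(subfx_irreducibleP px p_neq0) => q qx q0.
by apply: minp; apply/asboolP; exists q.
Qed.

Section PartialIso.
Import classical_sets.
Variables (k K : fieldType) (iota : {rmorphism k -> K}).
Hypothesis sep_K : separable_closure iota.

(* R is the graph of a k-isomorphism between two subfields of K. *)
Definition partial_iso (R : set (K * K)) : Prop :=
  [/\ forall c, R (iota c, iota c),
      forall u v, R u -> R v -> R (u.1 - v.1, u.2 - v.2),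
      forall u v, R u -> R v -> R (u.1 * v.1, u.2 * v.2),
      forall u, R u -> R (u.1^-1, u.2^-1)
    & forall u, R u -> (u.1 == 0) = (u.2 == 0)].

(** The field [F] stands for the domain, with [f1] its inclusion and [f2] the isomorphism. The
    minimal polynomial of [x] over [F] divides a separable polynomial coming from k, so its
    transport by [f2] has a root [y] in K, and x may be sent to y. *)
Lemma adjoin_partial_iso (F : fieldType) (f1 f2 : {rmorphism F -> K}) (x : K) :
  (forall c, exists a, f1 a = iota c /\ f2 a = iota c) ->
  exists R, [/\ partial_iso R, forall a, R (f1 a, f2 a) & exists y, R (x, y)].
Proof.
move=> base; have [p0 [sep0 root0]] := sep_K.1 x.
have [p1 p1E] : exists p1, map_poly f1 p1 = map_poly iota p0.
  pose g c := sval (cid (base c)).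
  have gE c : f1 (g c) = iota c by rewrite /g; case: cid => a [].
  exists (\poly_(i < size p0) g p0`_i); apply/polyP => i.
  rewrite !coef_map coef_poly; case: ltnP => [_|h] /=; first exact: gE.
  by rewrite nth_default ?rmorph0 // rmorph0.
have sep1 : separable_poly p1 by rewrite -(separable_map f1) p1E separable_map.
have [|p [p_neq0 irr_p px]] := irreducible_root_poly (separable_poly_neq0 sep1) (x := x) (f := f1).
  by rewrite p1E.
have dvd1 q : root (map_poly f1 q) x = (p %| q).
  apply/idP/idP => [qx|/dvdpP[r ->]]; last first.
    by rewrite rmorphM rootM px orbT.
  apply: contraT => pNq; have : coprimep p q by rewrite irreducible_poly_coprime.
  by rewrite -(coprimep_map f1) => /coprimep_root/(_ px); rewrite -rootE qx.
have sep_p : separable_poly p.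
  by apply: dvdp_separable sep1; rewrite -dvd1 p1E.
have [||y py] := sep_K.2 (map_poly f2 p); first by rewrite separable_map.
  by rewrite size_map_poly; have [] := irr_p.
have dvd2 q : root (map_poly f2 q) y = (p %| q).
  apply/idP/idP => [qy|/dvdpP[r ->]]; last first.
    by rewrite rmorphM rootM py orbT.
  apply: contraT => pNq; have : coprimep p q by rewrite irreducible_poly_coprime.
  by rewrite -(coprimep_map f2) => /coprimep_root/(_ py); rewrite -rootE qy.
pose ev (g : {poly F}) := ((map_poly f1 g).[x], (map_poly f2 g).[y]).
(* f1(g)(x) and f2(g)(y) vanish together, namely when p divides g. *)
exists (fun u => exists g, u = ev g); split.
- split=> [c|_ _ [g ->] [h ->]|_ _ [g ->] [h ->]|_ [g ->]|_ [g ->]].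
  + by have [a [e1 e2]] := base c; exists a%:P; rewrite /ev !map_polyC !hornerC /= e1 e2.
  + by exists (g - h); rewrite /ev !rmorphB !hornerE.
  + by exists (g * h); rewrite /ev !rmorphM !hornerE.
  (* If p divides g, both values are 0 and so are their inverses by convention; otherwise a Bezout
     relation provides a polynomial whose values are the inverses. *)
  + rewrite /=; have [pg|pNg] := boolP (p %| g).
      move: (pg); rewrite -dvd1 => /rootP ->; move: pg; rewrite -dvd2 => /rootP ->.
      by exists 0; rewrite /ev !rmorph0 !hornerC !invr0.
    have /Bezout_eq1_coprimepP[[a b] /= ab] : coprimep p g by rewrite irreducible_poly_coprime.
    exists b; rewrite /ev.
    have h1 : (map_poly f1 b).[x] * (map_poly f1 g).[x] = 1.
      move/(congr1 (fun q => (map_poly f1 q).[x])): ab.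
      by rewrite rmorphD !rmorphM /= !hornerE (rootP px) mulr0 add0r rmorph1 hornerC.
    have h2 : (map_poly f2 b).[y] * (map_poly f2 g).[y] = 1.
      move/(congr1 (fun q => (map_poly f2 q).[y])): ab.
      by rewrite rmorphD !rmorphM /= !hornerE (rootP py) mulr0 add0r rmorph1 hornerC.
    have n1 : (map_poly f1 g).[x] != 0 by rewrite -rootE dvd1.
    have n2 : (map_poly f2 g).[y] != 0 by rewrite -rootE dvd2.
    by rewrite -[X in (X, _)]mul1r -h1 mulfK // -[X in (_, X)]mul1r -h2 mulfK.
  + by rewrite /= -!rootE dvd1 dvd2.
- by move=> a; exists a%:P; rewrite /ev !map_polyC !hornerC.
- by exists y, 'X; rewrite /ev !map_polyX !hornerX.
Qed.

(** The domain of [R] is a subfield and [R] is single-valued on it, because zero corresponds only to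
    zero; this reduces the extension to adjoining one element. *)
Lemma extend_partial_iso (R : set (K * K)) (x : K) : partial_iso R ->
  exists R', [/\ partial_iso R', (R `<=` R')%classic & exists y, R' (x, y)].
Proof.
move=> [base RB RM RV R0].
have Runiq u v v' : R (u, v) -> R (u, v') -> v = v'.
  move=> r r'; have /esym := R0 _ (RB _ _ r r').
  by rewrite /= subrr eqxx subr_eq0 => /eqP.
have R00 : R (0, 0) by have := base 0; rewrite rmorph0.
have R11 : R (1, 1) by have := base 1; rewrite rmorph1.
pose dom : {pred K} := fun u => `[< exists v, R (u, v) >].
have dom_div : divring_closed dom.
  split; first by apply/asboolP; exists 1.
    move=> u v /asboolP[u' hu] /asboolP[v' hv]; apply/asboolP; exists (u' - v').
    exact: RB hu hv.
  move=> u v /asboolP[u' hu] /asboolP[v' hv]; apply/asboolP; exists (u' / v').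
  exact: RM hu (RV _ hv).
pose domC := GRing.isDivringClosed.Build K dom dom_div.
pose D : divringClosed K := HB.pack dom domC.
pose TF : fieldType := subfield_type D.
have ex2 (u : TF) : exists v, R (val u, v) by case: u => u /= /asboolP.
pose g (u : TF) := sval (cid (ex2 u)).
have gR u : R (val u, g u) by exact: (svalP (cid (ex2 u))).
pose f1 : {rmorphism TF -> K} := GRing.RMorphism.clone _ _ (val : TF -> K) _.
have g_uniq u v : R (val u, v) -> g u = v by exact: Runiq.
have g_add : zmod_morphism g.
  by move=> u v; apply: g_uniq; rewrite raddfB; exact: RB (gR u) (gR v).
have g_mon : monoid_morphism g.
  split=> [|u v]; apply: g_uniq; first by rewrite rmorph1.
  by rewrite rmorphM; exact: RM (gR u) (gR v).
pose gA := GRing.isZmodMorphism.Build _ _ g g_add.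
pose gM := GRing.isMonoidMorphism.Build _ _ g g_mon.
pose f2 : {rmorphism TF -> K} := HB.pack g gA gM.
have dR u v : R (u, v) -> exists a, f1 a = u /\ f2 a = v.
  move=> r;  have du : u \in D by apply/asboolP; exists v.
  exists (Subfield du : TF); split=> //; exact: g_uniq.
have [|R' [iR' sR' yR']] := @adjoin_partial_iso TF f1 f2 x.
  by move=> c; exact: dR (base c).
by exists R'; split=> // -[u v] /dR[a [<- <-]]; exact: sR'.
Qed.

(** A maximal extension given by Zorn's lemma is defined on all of K, since one more element could
    always be adjoined. *)
Lemma partial_iso_extends_to_gal (R : set (K * K)) : partial_iso R ->
  exists s : gal iota, forall u, R u -> s u.1 = u.2.
Proof.
move=> iR; pose P (A : set (K * K)) := A = set0 \/ partial_iso A /\ (R `<=` A)%classic.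
have [A [[A0|[iA RA]] maxA]] : exists A, P A /\ forall B, (A `<` B)%classic -> ~ P B.
  apply: Zorn_bigcup => F FP Ftot.
  have [[A [FA [iA RA]]]|noA] := pselect (exists A, F A /\ partial_iso A /\ (R `<=` A)%classic).
    right; split; last by move=> u Ru; exists A => //; exact: RA.
    have fpi X u : F X -> X u -> partial_iso X.
      by move=> FX Xu; have [X0|[]] := FP _ FX => //; rewrite X0 in Xu.
    have fpair u v : (\bigcup_(X in F) X)%classic u -> (\bigcup_(X in F) X)%classic v ->
        exists X, [/\ F X, partial_iso X, X u & X v].
      move=> [X FX Xu] [Y FY Yv]; have [XY|YX] := Ftot _ _ FX FY.
        by exists Y; split=> //; [exact: fpi Yv | exact: XY].
      by exists X; split=> //; [exact: fpi Xu | exact: YX].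
    split=> [c|u v Fu Fv|u v Fu Fv|u Fu|u Fu].
    - by exists A => //; case: iA.
    - by have [X [FX [_ h _ _ _] Xu Xv]] := fpair _ _ Fu Fv; exists X => //; exact: h.
    - by have [X [FX [_ _ h _ _] Xu Xv]] := fpair _ _ Fu Fv; exists X => //; exact: h.
    - by have [X [FX [_ _ _ h _] Xu _]] := fpair _ _ Fu Fu; exists X => //; exact: h.
    - by have [X [FX [_ _ _ _ h] Xu _]] := fpair _ _ Fu Fu; exact: h.
  left; apply/seteqP; split=> // u [X FX Xu].
  have [X0|XP] := FP _ FX; first by rewrite X0 in Xu.
  by case: noA; exists X.
- exfalso; apply: (maxA R); last by right; split.
  rewrite A0; split=> // h; have [/(_ 0) base _ _ _ _] := iR.
  exact: h base.
have total x : exists y, A (x, y).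
  have [B [iB AB [y By]]] := extend_partial_iso x iA.
  exists y; have [AeB|nAB] := pselect (A = B); first by rewrite AeB.
  case: (maxA B); last by right; split=> //; exact: subset_trans AB.
  by rewrite properEneq; split=> //; apply/eqP.
have [base AB AM AV A0] := iA.
have Auniq u v v' : A (u, v) -> A (u, v') -> v = v'.
  move=> r r'; have /esym := A0 _ (AB _ _ r r').
  by rewrite /= subrr eqxx subr_eq0 => /eqP.
have A11 : A (1, 1) by have := base 1; rewrite rmorph1.
pose g x := sval (cid (total x)).
have gA x : A (x, g x) by exact: (svalP (cid (total x))).
have g_add : zmod_morphism g.
  by move=> u v; apply: Auniq (gA _) _; exact: AB (gA u) (gA v).
have g_mon : monoid_morphism g.
  split=> [|u v]; apply: Auniq (gA _) _ => //; exact: AM (gA u) (gA v).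
pose gZ := GRing.isZmodMorphism.Build _ _ g g_add.
pose gM := GRing.isMonoidMorphism.Build _ _ g g_mon.
pose f : {rmorphism K -> K} := HB.pack g gZ gM.
have fk c : f (iota c) = iota c by apply: Auniq (gA _) _.
(* An injective endomorphism over k permutes the finitely many roots of a polynomial over k, so it
   reaches [y]. *)
have f_surj y : exists x, f x = y.
  have [p [sp py]] := sep_K.1 y.
  have [rs [_ urs rsP]] : exists rs : seq K,
    [/\ size rs = (size (map_poly iota p)).-1, uniq rs
      & forall x, root (map_poly iota p) x = (x \in rs)].
    by apply: sep_closed_roots sep_K _ _; rewrite separable_map.
  have sub : {subset map f rs <= rs}.
    move=> _ /mapP[x xrs ->]; rewrite -rsP /root.
    rewrite -rsP in xrs; rewrite -(rmorph0 f) -(rootP xrs) -horner_map -map_poly_comp.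
    by rewrite (eq_map_poly fk).
  have urs' : uniq (map f rs) by rewrite map_inj_uniq //; exact: fmorph_inj.
  have [_ eqrs] := uniq_min_size urs' sub (eq_leq (esym (size_map f rs))).
  by move: py; rewrite rsP -eqrs => /mapP[x _ ->]; exists x.
have f_bij : bijective f.
  exists (fun y => sval (cid (f_surj y))) => [x|y]; last exact: (svalP (cid (f_surj y))).
  by apply: (fmorph_inj f); exact: (svalP (cid (f_surj (f x)))).
exists (exist _ f (conj f_bij fk)) => -[u v] /RA Auv /=.
exact: Auniq (gA _) Auv.
Qed.

End PartialIso.

(** * Homomorphisms into the separable closure and Hilbert 90 *)

Section Homs.
Variables (k K : fieldType) (iota : {rmorphism k -> K}).

(** Dedekind's argument: subtracting [nu ord0 a] times the relation at [x] from the relation at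
    [a * x] eliminates the first character, and [a] is chosen so that a given other coefficient
    survives. *)
Lemma homs_free (L : falgType k) r (nu : 'I_r -> hom_k iota L) (u : 'I_r -> K) :
  injective nu -> (forall x, \sum_i u i * nu i x = 0) -> forall i, u i = 0.
Proof.
elim: r nu u => [|r IH] nu u nu_inj sum0 i; first by case: i.
have tail0 j : u (lift ord0 j) = 0.
  have [a na] : exists a, nu (lift ord0 j) a != nu ord0 a.
    apply: contrapT => /forallNP eqa; have : nu (lift ord0 j) = nu ord0.
      by apply: homP => a; have /negP := eqa a; rewrite negbK => /eqP.
    by move/nu_inj.
  have : u (lift ord0 j) * (nu (lift ord0 j) a - nu ord0 a) = 0.
    apply: (IH (fun l => nu (lift ord0 l))
               (fun l => u (lift ord0 l) * (nu (lift ord0 l) a - nu ord0 a))) => [l l'|x].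
      by move/nu_inj/lift_inj.
    have : \sum_i u i * nu i (a * x) - nu ord0 a * \sum_i u i * nu i x = 0.
      by rewrite !sum0 mulr0 subrr.
    rewrite mulr_sumr -sumrB big_ord_recl /= rmorphM mulrCA subrr add0r => h; rewrite -[RHS]h.
    by apply: eq_bigr => l _; rewrite rmorphM mulrBr mulrBl mulrA [nu ord0 a * _]mulrCA mulrA.
  by move/eqP; rewrite mulf_eq0 subr_eq0 (negPf na) orbF => /eqP.
have [j ->|->] := unliftP ord0 i; first exact: tail0.
have := sum0 1; rewrite big_ord_recl rmorph1 mulr1 big1 ?addr0 // => j _.
by rewrite tail0 mul0r.
Qed.

Definition hom_mx (L : falgType k) n (nu : 'I_n -> hom_k iota L) (e : n.-tuple L) : 'M[K]_n :=
  \matrix_(i, j) nu i e`_j.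

(** A row vector killing the matrix is a linear relation between the [nu i] on a basis, hence
    everywhere, so independence of characters applies. *)
Lemma hom_mx_unit (L : falgType k) n (nu : 'I_n -> hom_k iota L) (e : n.-tuple L) :
  injective nu -> basis_of fullv e -> hom_mx nu e \in unitmx.
Proof.
move=> nu_inj he; rewrite -row_free_unit -kermx_eq0; apply/rowV0P => u /sub_kermxP ue.
apply/rowP => i; rewrite mxE; apply: (homs_free nu_inj (u := u 0)) => x.
rewrite (coord_basis he (memvf x)).
transitivity (\sum_j iota (coord e j x) * (u *m hom_mx nu e) 0 j).
  under eq_bigr => l _ do rewrite rmorph_sum /= mulr_sumr.
  rewrite exchange_big; apply: eq_bigr => j _; rewrite mxE mulr_sumr.
  by apply: eq_bigr => l _; rewrite hom_linear mxE mulrCA.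
by rewrite ue; apply: big1 => j _; rewrite mxE mulr0.
Qed.

Lemma hom_perm_ex (L : falgType k) n (nu : 'I_n -> hom_k iota L) (s : gal iota) :
  bijective nu -> exists sigma : 'S_n, forall j, nu (sigma j) = hom_act s (nu j).
Proof.
move=> [mu numu munu].
have inj : injective (fun j => mu (hom_act s (nu j))).
  move=> i j /(congr1 (hom_act s^-1%g \o nu)) /=.
  by rewrite !munu !hom_actK; exact: can_inj numu _ _.
by exists (perm inj) => j; rewrite permE munu.
Qed.

(** The bijection [mu] shows that Hom_k(L, K) has n elements, so injectivity suffices. *)
Lemma bij_hom_of_inj (L : falgType k) n (nu mu : 'I_n -> hom_k iota L) :
  bijective mu -> injective nu -> bijective nu.
Proof.
move=> [mu' _ muK] nu_inj; pose f i := mu' (nu i).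
have f_inj : injective f by apply: inj_comp nu_inj; exact: can_inj muK.
have [g fg gf] := injF_bij f_inj.
exists (g \o mu') => [i|phi] /=; first exact: fg.
by apply: (can_inj muK); exact: gf.
Qed.

Hypothesis sep_K : separable_closure iota.

(** The elements are adjoined one at a time by their minimal polynomials. The result is an abstract
    extension with an embedding [j], so that linear algebra over k in finite dimension is available
    for it. *)
Lemma finite_subext (S : seq K) :
  exists (M : fieldExtType k) (j : hom_k iota M), {in S, forall x, exists a, j a = x}.
Proof.
elim: S => [|x S [M [j jS]]].
  have iotaA : forall c : k, (iota : {rmorphism k^o -> K}) c%:A = iota c.
    by move=> c; rewrite /= /GRing.scale /= mulr1.
  by exists k^o, (exist _ (iota : {rmorphism k^o -> K}) iotaA).
have [p0 [sep0 p0x]] := sep_K.1 x.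
have [||p [p_neq0 irr_p px]] := @irreducible_root_poly M K j x (map_poly (in_alg M) p0).
- by rewrite map_poly_eq0 separable_poly_neq0.
- by rewrite -map_poly_comp (eq_map_poly (svalP j)).
pose N := baseFieldType (SubFieldExtType px irr_p).
have jN c : (subfx_inj (iota := j) (z := x) (p := p) : {rmorphism N -> K}) c%:A = iota c.
  rewrite baseField_scaleE /= (subfx_inj_base px p_neq0).
  exact: (svalP j).
exists N, (exist _ (subfx_inj (iota := j) (z := x) (p := p) : {rmorphism N -> K}) jN).
move=> y; rewrite inE => /predU1P[->|/jS[a <-]].
  by exists (subfx_root j x p); exact: subfx_inj_root px p_neq0.
by exists (a%:A : SubFieldExtType px irr_p); exact: subfx_inj_base px p_neq0 a.
Qed.

Lemma separable_subext (M : fieldExtType k) (j : hom_k iota M) : separable 1%VS {:M}%VS.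
Proof.
apply/separableP => a _; have [p [sep_p pa]] := sep_K.1 (j a).
apply/(@separable_elementP _ _ 1%AS); exists (map_poly (in_alg M) p).
rewrite separable_map -(fmorph_root j) -map_poly_comp (eq_map_poly (svalP j)).
by split=> //; apply/polyOver1P; exists p.
Qed.

(** The pairs (j a, phi a) form the graph of an isomorphism between two subfields of K. *)
Lemma extend_hom (M : fieldExtType k) (j phi : hom_k iota M) :
  exists s : gal iota, forall a, s (j a) = phi a.
Proof.
pose R (u : K * K) := exists a, u = (j a, phi a).
have [|s sP] := @partial_iso_extends_to_gal _ _ iota sep_K R; last first.
  by exists s => a; apply: (sP (j a, phi a)); exists a.
split=> [c|_ _ [a ->] [b ->]|_ _ [a ->] [b ->]|_ [a ->]|_ [a ->]] /=.
- by exists c%:A; rewrite (svalP j) (svalP phi).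
- by exists (a - b); rewrite !rmorphB.
- by exists (a * b); rewrite !rmorphM.
- by exists a^-1; rewrite !fmorphV.
- by rewrite !fmorph_eq0.
Qed.

(** Every embedding of a finite M containing [x] extends to K, hence maps the element [a]
    corresponding to [x] to [x] itself. Comparing coordinates of [a] and 1 then exhibits [x] as a
    quotient of two elements of k. *)
Lemma gal_fixed (x : K) : (forall s : gal iota, s x = x) -> exists c, x = iota c.
Proof.
move=> fix_x; have [M [j jx]] := finite_subext [:: x].
have [|a ja] := jx x; first exact: mem_head.
have [nu nu_bij] := field_homs sep_K (separable_subext j).
have nu_a i : nu i a = x.
  by have [s sP] := extend_hom j (nu i); rewrite -sP ja fix_x.
pose e := vbasis {:M}; have he : basis_of fullv e by exact: vbasisP.
(* a and 1 become proportional under all embeddings nu i, whose matrix is invertible. *)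
have coordP l : iota (coord e l a) = x * iota (coord e l 1).
  pose v : 'cV[K]_(\dim {:M}) := \col_l (iota (coord e l a) - x * iota (coord e l 1)).
  have : hom_mx nu e *m v = 0.
    apply/colP => i; rewrite !mxE.
    transitivity (nu i a - x * nu i 1); last by rewrite nu_a rmorph1 mulr1 subrr.
    rewrite [in nu i a](coord_basis he (memvf a))
      [in nu i 1](coord_basis he (memvf 1)) !rmorph_sum /=.
    rewrite mulr_sumr -sumrB; apply: eq_bigr => l' _; rewrite !mxE !hom_linear mulrBr.
    by rewrite ![nu i _ * _]mulrC !mulrA.
  move/(congr1 (mulmx (invmx (hom_mx nu e)))); rewrite mulKmx ?mulmx0; last first.
    by apply: hom_mx_unit he; exact: bij_inj.
  by move/colP/(_ l); rewrite !mxE => /eqP; rewrite subr_eq0 => /eqP.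
have [l l0] : exists l, coord e l 1 != 0.
  apply: contrapT => /forallNP h; have /eqP := oner_neq0 M; apply.
  rewrite (coord_basis he (memvf 1)) big1 // => l _.
  by have /negP := h l; rewrite negbK => /eqP ->; rewrite scale0r.
exists (coord e l a / coord e l 1); rewrite fmorph_div coordP mulfK //.
by rewrite fmorph_eq0.
Qed.

End Homs.

Section FixedField.
Variables (k K : fieldType) (iota : {rmorphism k -> K}).
Hypothesis sep_K : separable_closure iota.

(** K is also a separable closure of M, so the statement over k applies with [j] as base
    embedding. *)
Lemma gal_fixed_over (M : fieldExtType k) (j : hom_k iota M) (x : K) :
  (forall s : gal iota, (forall a, s (j a) = j a) -> s x = x) -> exists a, x = j a.
Proof.
move=> fix_x; apply: (@gal_fixed _ _ j).
  split; last exact: sep_K.2.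
  move=> y; have [p [sp py]] := sep_K.1 y; exists (map_poly (in_alg M) p).
  by rewrite separable_map -map_poly_comp (eq_map_poly (svalP j)).
move=> s; have sk c : s (iota c) = iota c by rewrite -(svalP j); exact: gal_fix.
exact: (fix_x (exist _ (gal_fun s) (conj (gal_bij s) sk)) (gal_fix s)).
Qed.

(** Continuity enters through the finite set [S]: on a finite M containing [S], the cocycle is
    trivial on Gal(K/M), so the averaging sums run over the finitely many embeddings of M. *)
Lemma hilbert90 n (w : gal iota -> 'M[K]_n) (S : seq K) :
  (forall s, w s \in unitmx) ->
  (forall s t : gal iota, w (s * t)%g = w s *m map_mx s (w t)) ->
  (forall t : gal iota, {in S, forall x, t x = x} -> w t = 1%:M) ->
  exists2 A, A \in unitmx & forall s : gal iota, w s *m map_mx s A = A.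
Proof.
move=> w_unit wM wS; have [M [j jS]] := finite_subext sep_K S.
have wj (t : gal iota) : (forall a, t (j a) = j a) -> w t = 1%:M.
  by move=> tj; apply: wS => x /jS[a <-].
have [nu nu_bij] := field_homs sep_K (separable_subext sep_K j).
set d := \dim {:M} in nu nu_bij.
pose e := vbasis {:M}; have he : basis_of fullv e by exact: vbasisP.
pose t i := sval (cid (extend_hom sep_K j (nu i))).
have tP i a : t i (j a) = nu i a by exact: (svalP (cid (extend_hom sep_K j (nu i)))).
(* The columns of the b l are the sums of w_t t(v), t over Gal(K/k)/Gal(K/M) and *)
(* v in a k-basis of M^n: by independence of characters they span K^n.            *)
pose b (l : 'I_d) := \sum_i nu i e`_l *: w (t i).
have b_inv s l : w s *m map_mx s (b l) = b l.
  have [sg sgP] := hom_perm_ex s nu_bij.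
  (* The automorphisms [s * t i] and [t (sg i)] agree on M, hence differ by an element of Gal(K/M),
     where [w] is trivial. *)
  have wt i : w (s * t i)%g = w (t (sg i)).
    pose h := ((t (sg i))^-1 * (s * t i))%g.
    have -> : (s * t i)%g = (t (sg i) * h)%g by rewrite mulVKg.
    rewrite wM (wj h) ?map_mx1 ?mulmx1 // => a.
    by rewrite !galM tP -[s _]/(hom_act s (nu i) a) -sgP -tP galK.
  rewrite /b [RHS](reindex_inj (@perm_inj _ sg)) raddf_sum mulmx_sumr /=; apply: eq_bigr => i _.
  by rewrite map_mxZ -scalemxAr -wM wt sgP.
pose T := ('I_d * 'I_n)%type.
pose B : 'M[K]_(n, #|{: T}|) :=
  \matrix_(i, c) b (enum_val c).1 i (enum_val c).2.
have B_free : row_full B^T.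
  rewrite /row_full mxrank_tr -[_ == _]/(row_free B) -kermx_eq0.
  apply/rowV0P => u /sub_kermxP uB.
  have uw i : u *m w (t i) = 0.
    apply/rowP => c; rewrite [RHS]mxE.
    apply: (homs_free (bij_inj nu_bij) (u := fun i => (u *m w (t i)) 0 c)) => x.
    have ub l : u *m b l = 0.
      apply/rowP => c'; have /rowP/(_ (enum_rank (l, c'))) := uB; rewrite !mxE => uB0.
      by rewrite -[RHS]uB0; apply: eq_bigr => l' _; rewrite !mxE enum_rankK.
    rewrite (coord_basis he (memvf x)).
    transitivity (\sum_l iota (coord e l x) * (u *m b l) 0 c); last first.
      by apply: big1 => l _; rewrite ub mxE mulr0.
    under eq_bigr => i' _ do rewrite rmorph_sum /= mulr_sumr.
    rewrite exchange_big; apply: eq_bigr => l _; rewrite mulmx_sumr summxE mulr_sumr.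
    by apply: eq_bigr => i1 _; rewrite hom_linear -scalemxAr [in RHS]mxE mulrCA [_ * nu _ _]mulrC.
  have d_gt0 : (0 < d)%N by rewrite adim_gt0.
  by rewrite -[u](mulmxK (w_unit (t (Ordinal d_gt0)))) uw mul0mx.
pose f := fullrankfun B_free.
exists (\matrix_(i, c) b (enum_val (f c)).1 i (enum_val (f c)).2).
  rewrite -unitmx_tr (_ : _^T = rowsub f B^T); first exact: fullrowsub_unit.
  by apply/matrixP => i c; rewrite !mxE.
move=> s; apply/matrixP => i c; rewrite [RHS]mxE -[in RHS](b_inv s) !mxE.
by apply: eq_bigr => l _; rewrite !mxE.
Qed.

End FixedField.

(** * The stabiliser of the Fermat form *)

Section FermatAutomorphisms.
Variables (F : fieldType) (n m : nat).
Implicit Types (A : 'M[F]_n) (i j l : 'I_n).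

Definition lin_form A i : {mpoly F[n]} := \sum_(j < n) A i j *: 'X_j.

Lemma lin_substX A i : lin_subst A 'X_i = lin_form A i.
Proof. by rewrite /lin_subst comp_mpolyXU -tnth_nth tnth_mktuple. Qed.

Lemma lin_subst_fermat A : lin_subst A (fermat_poly F n m) = \sum_i lin_form A i ^+ m.
Proof.
rewrite /fermat_poly /lin_subst rmorph_sum; apply: eq_bigr => i _ /=.
by rewrite rmorphXn /= -[_ \mPo _]/(lin_subst A 'X_i) lin_substX.
Qed.

Lemma mderivXn (p : {mpoly F[n]}) i r : mderiv i (p ^+ r) = r%:R *: (p ^+ r.-1 * mderiv i p).
Proof.
elim: r => [|r IH]; first by rewrite expr0 scale0r -mpolyC1 mderivC.
rewrite exprS mderivM IH /= -scalerAr mulrA -exprS [mderiv i p * _]mulrC.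
case: r {IH} => [|r] /=; first by rewrite scale0r addr0 scale1r.
by rewrite -[X in X + _]scale1r -scalerDl nat1r.
Qed.

Lemma mderiv_lin_form A i j : mderiv j (lin_form A i) = (A i j)%:MP.
Proof.
rewrite /lin_form raddf_sum /= (bigD1 j) //= big1 => [|l lj].
  rewrite mderivZ mderivX mnm1E eqxx scale1r addr0.
  rewrite (_ : _ - _ = 0)%MM ?mpolyX0 ?alg_mpolyC //.
  by apply/mnmP => i'; rewrite mnmBE subnn mnm0E.
by rewrite mderivZ mderivX mnm1E (negPf lj) scale0r scaler0.
Qed.

(** The chain rule, written as a substitution by [A] so that it can be undone by the inverse
    matrix. *)
Lemma mderiv2_fermat A j l : mderiv l (mderiv j (lin_subst A (fermat_poly F n m))) =
  lin_subst A (\sum_i ((m * m.-1)%:R * (A i j * A i l)) *: 'X_i ^+ m.-2).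
Proof.
rewrite lin_subst_fermat /lin_subst (raddf_sum (mderiv j)) (raddf_sum (mderiv l)) raddf_sum /=.
apply: eq_bigr => i _.
rewrite mderivXn mderiv_lin_form [_ * _%:MP]mulrC mul_mpolyC scalerA mderivZ mderivXn.
rewrite mderiv_lin_form [_ * _%:MP]mulrC mul_mpolyC !scalerA comp_mpolyZ rmorphXn /=.
rewrite -[_ \mPo _]/(lin_subst A 'X_i).
by rewrite lin_substX natrM; congr (_ *: _); rewrite -!mulrA; congr (_ * _); exact: mulrCA.
Qed.

(** Mixed second derivatives of P vanish, which forces at most one nonzero entry in each row of [A].
    Invertibility makes [A] monomial, and evaluating P shows that its entries are m-th roots of
    unity. *)
Lemma fermat_stabilizer (A : GL F n) : (2 < m)%N -> m%:R != 0 :> F -> m.-1%:R != 0 :> F ->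
  lin_subst A (fermat_poly F n m) = fermat_poly F n m -> in_wreath m A.
Proof.
move=> m2 m0 m10 stab.
have row1 i j l : j != l -> A i j * A i l = 0.
  move=> jl; have := mderiv2_fermat A j l; rewrite stab -[X in mderiv j X]lin_subst1.
  rewrite mderiv2_fermat [X in lin_subst _ X = _]big1 => [|i' _]; last first.
    rewrite !mxE; have [->|_] := eqVneq i' j; last by rewrite mul0r mulr0 scale0r.
    by rewrite (negPf jl) !mulr0 scale0r.
  rewrite [LHS]/(lin_subst _ _) /lin_subst comp_mpoly0 => /esym/(congr1 (lin_subst (invmx A))).
  rewrite lin_substM mulmxV ?GL_unit // lin_subst1 /lin_subst comp_mpoly0.
  move/(congr1 (mcoeff (U_(i) *+ m.-2))); rewrite mcoeff0 raddf_sum (bigD1 i) //= big1.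
    rewrite mcoeffZ mpolyXn mcoeffX eqxx mulr1 addr0 natrM => /eqP.
    by rewrite !mulf_eq0 (negPf m0) (negPf m10) -mulf_eq0 => /eqP.
  move=> i' ii'; rewrite mcoeffZ mpolyXn mcoeffX; case: eqP => [|_]; last by rewrite mulr0.
  (* Here m > 2 is essential: the monomials X_i^(m-2) are distinct only because the exponent is
     positive. *)
  move/(congr1 (fun mm : 'X_{1..n} => mm i)); rewrite !mulmnE !mnm1E eqxx (negPf ii').
  by case: m m2 => [|[|[]]].
have col_neq0 j : exists i, A i j != 0.
  apply: contrapT => /forallNP h; have : col j A = 0.
    by apply/colP => i; rewrite !mxE; have /negP := h i; rewrite negbK => /eqP.
  move/(congr1 (fun v => invmx A *m v)); rewrite mulmx0 colE mulKmx ?GL_unit //.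
  by move/colP/(_ j)/eqP; rewrite !mxE !eqxx oner_eq0.
pose sg j := sval (cid (col_neq0 j)).
have sgP j : A (sg j) j != 0 by exact: (svalP (cid (col_neq0 j))).
have sg_inj : injective sg.
  move=> j j' e; apply/eqP; apply: contraT => jj'; have /eqP := row1 (sg j) j j' jj'.
  by rewrite mulf_eq0 (negPf (sgP j)) e (negPf (sgP j')).
pose s := perm sg_inj; have sP j : A (s j) j != 0 by rewrite permE.
have A0 i j : i != s j -> A i j = 0.
  move=> ij; have ji : (s^-1)%g i != j by apply: contraNneq ij => <-; rewrite permKV.
  have := sP ((s^-1)%g i); have /eqP := row1 i _ _ ji.
  by rewrite permKV mulf_eq0 => /orP[->|/eqP].
(* Both sides of P(AX) = P are evaluated at the j-th unit vector. *)
have Am j : A (s j) j ^+ m = 1.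
  move/(congr1 (meval (fun l => (l == j)%:R))): stab; rewrite lin_subst_fermat.
  rewrite /fermat_poly !rmorph_sum /= (bigD1 (s j)) //= big1 => [|i ij]; last first.
    rewrite rmorphXn /= /lin_form raddf_sum big1 /= ?expr0n; first by case: (m) m2.
    move=> l _; rewrite mevalZ mevalXU; case: eqP => [->|]; rewrite ?mulr0 //.
    by rewrite A0 ?mul0r.
  rewrite (bigD1 j) //= big1 => [|i ij]; last first.
    by rewrite rmorphXn /= mevalXU (negPf ij) expr0n; case: (m) m2.
  rewrite !addr0 !rmorphXn /= mevalXU eqxx expr1n => <-; congr (_ ^+ _).
  rewrite /lin_form raddf_sum (bigD1 j) //= big1 => [|l lj]; last first.
    by rewrite mevalZ mevalXU (negPf lj) mulr0.
  by rewrite mevalZ mevalXU eqxx mulr1 addr0.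
exists (fun i => A i ((s^-1)%g i)), s; split=> [i|].
  by rewrite -{1}(permKV s i) Am.
apply/matrixP => i j; rewrite mxE; case: (eqVneq i (s j)) => [->|ij].
  by rewrite permK mulr1.
by rewrite mulr0 A0.
Qed.

End FermatAutomorphisms.

(** * Projective forms and the map theta *)

Section Forms.
Variables (k K : fieldType) (iota : {rmorphism k -> K}) (n m : nat).
Variables (n_gt0 : (0 < n)%N) (m_gt2 : (2 < m)%N).
Hypothesis char_k : forall p : nat, p \in [pchar k] -> ~~ (p %| m`!)%N.
Hypothesis sep_K : separable_closure iota.
Local Notation G := (gal iota).
Local Notation P := (fermat K n_gt0 m_gt2).
Local Notation fermat_morph := (@form_morph K n m).

Lemma natr_neq0 r : (0 < r <= m)%N -> r%:R != 0 :> K.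
Proof.
move=> /andP[r0 rm]; rewrite -(rmorph_nat iota) fmorph_eq0.
apply/negP => h; have [p hp] := natf0_pchar r0 h; have := char_k hp.
have pr : (p %| r)%N by rewrite (dvdn_pcharf hp).
by rewrite (dvdn_trans pr) // dvdn_fact // r0.
Qed.

Lemma in_wreath_of_stabilizer (A : GL K n) :
  lin_subst A (fermat_poly K n m) = fermat_poly K n m -> in_wreath m A.
Proof.
apply: fermat_stabilizer => //; apply: natr_neq0; first by rewrite leqnn andbT; case: (m) m_gt2.
by rewrite leq_pred andbT; case: (m) m_gt2 => [|[|r]].
Qed.

(* K contains the m-th roots, so the scalar in P(AX) = c Q can be absorbed by A. *)
Lemma fermat_morph_normal (Q : form K n m) g : fermat_morph Q P g ->
  exists A : GL K n, PGL_of A = g /\ lin_subst A (fermat_poly K n m) = Q.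
Proof.
move=> [A [<- [c [c0 eA]]]].
have [|y ym] := @root_ex _ _ iota sep_K m m_gt2 char_k c^-1; first by rewrite invr_eq0.
have y0 : y != 0.
  apply: contra_eq_neq ym => ->; rewrite expr0n; case: (m) m_gt2 => //= *.
  by rewrite eq_sym invr_eq0.
have yA_unit : y *: (A : 'M_n) \in unitmx by rewrite unitmxZ ?unitfE ?GL_unit.
exists (MkGL yA_unit); split; first by apply/PGL_ofP; exists y.
rewrite -[RHS](scale1r (form_poly Q)) -(mulVf c0) -scalerA -eA -ym /= !lin_subst_fermat scaler_sumr.
apply: eq_bigr => i _; rewrite -exprZn; congr (_ ^+ _); rewrite /lin_form scaler_sumr.
by apply: eq_bigr => j _; rewrite mxE scalerA.
Qed.

(** A representative normalised so that P(AX) = P lies in the stabiliser, which is W. *)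
Lemma fermat_autP (g : PGL K n) :
  fermat_morph P P g <-> exists w : GL K n, in_wreath m w /\ PGL_of w = g.
Proof.
split=> [/fermat_morph_normal[A [<- eA]]|[w [ww <-]]].
  by exists A; split=> //; exact: in_wreath_of_stabilizer.
exact: in_wreath_fermat.
Qed.

Lemma wreath_scalarP (w : GL K n) : in_wreath m w ->
  (PGL_of w = 1%g <-> exists z : K, z ^+ m = 1 /\ GLmx w = z%:M).
Proof.
move=> [mu [s [hmu ew]]]; rewrite -PGL_of1; split=> [/PGL_ofP[c [c0 /= e]]|[z [zm e]]].
  exists c; rewrite e scalemx1; split=> //.
  have := ew; rewrite e scalemx1 => /matrixP/(_ (Ordinal n_gt0) (Ordinal n_gt0)).
  rewrite !mxE eqxx mulr1n; case: eqP => [_|_ c00]; first by rewrite mulr1 => ->.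
  by move: c0; rewrite c00 mulr0 eqxx.
apply/PGL_ofP; exists z; split; last by rewrite e scalemx1.
exact: (root1_neq0 m_gt2 zm).
Qed.

Lemma gal_fixed_mx p q (A : 'M[K]_(p, q)) : (forall s : G, map_mx s A = A) ->
  exists B, A = map_mx iota B.
Proof.
move=> fixA; have cP i j : exists c, A i j = iota c.
  by apply: (gal_fixed sep_K) => s; have /matrixP/(_ i j) := fixA s; rewrite mxE.
exists (\matrix_(i, j) sval (cid (cP i j))); apply/matrixP => i j.
by rewrite !mxE -(svalP (cid (cP i j))).
Qed.

Lemma GL_entry_neq0 (A : GL K n) : exists i j, A i j != 0.
Proof.
apply: contrapT => h; have A0 : (A : 'M_n) = 0.
  apply/matrixP => i j; rewrite mxE; apply/eqP; apply: contrapT => /negP Aij.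
  by apply: h; exists i, j.
have := mulmxV (GL_unit A); rewrite A0 mul0mx => /matrixP/(_ (Ordinal n_gt0) (Ordinal n_gt0))/eqP.
by rewrite !mxE eqxx eq_sym oner_eq0.
Qed.

(* Scaling one entry to 1 makes a representative of a fixed class itself fixed. *)
Lemma gal_fixed_PGL (g : PGL K n) : (forall s : G, PGLact s g = g) ->
  exists (B : GL k n) (hB : map_mx iota B \in unitmx), g = PGL_of (MkGL hB).
Proof.
rewrite -(PGL_reprK g); set A := repr g => fixA.
have [i [j Aij]] := GL_entry_neq0 A.
have [|B eB] := @gal_fixed_mx _ _ ((A i j)^-1 *: (A : 'M_n)).
  move=> s; have /= := fixA s; rewrite PGLactE => /PGL_ofP[c [c0 /= e]].
  have /matrixP/(_ i j) := e; rewrite !mxE => eij.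
  by rewrite map_mxZ e fmorphV eij scalerA invfM mulrAC mulVf ?mul1r.
have uB' : map_mx iota B \in unitmx by rewrite -eB unitmxZ ?GL_unit // unitfE invr_eq0.
have uB : B \in unitmx by rewrite map_unitmx in uB'.
exists (MkGL uB), uB'; apply/PGL_ofP; exists (A i j); split=> //=.
by rewrite -eB scalerA mulfV // scale1r.
Qed.

(** If [b] relates the two cocycles, h^-1 b^-1 g is an isomorphism over K fixed by the Galois group,
    and so is represented by a matrix over k. *)
Lemma theta_injective : injective (@theta k K iota n m n_gt0 m_gt2).
Proof.
move=> e e'; rewrite -(repK e) -(repK e'); set Q := rep e; set R := rep e'.
have [g hg] := svalP Q; have [h hh] := svalP R.
rewrite (thetaE hg) (thetaE hh) => /cls_eq[|b [hb eb]]; first exact: cohomologous_equiv.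
pose f := (h^-1 * b^-1 * g)%g.
have fix_f (s : G) : PGLact s f = f.
  have := eb s; rewrite /= !PGLact_inv !mulgA => es.
  rewrite /f !PGLact_mul !PGLact_inv; apply: (@mulgI _ h).
  by rewrite !mulgA es mulgK mulgVK mulgV mul1g.
have hf : fermat_morph (base_change iota (sval Q)) (base_change iota (sval R)) f.
  by rewrite /f -mulgA; exact: form_morphM (form_morphM hg (form_morphV hb)) (form_morphV hh).
have [B [uB fB]] := gal_fixed_PGL fix_f.
move: hf; rewrite fB => /form_morph_of[c [c0 ec]].
apply/cls_eq; first exact: pform_iso_equiv.
have [mm Qmm] : exists mm, (form_poly (sval Q))@_mm != 0.
  apply: contrapT => /forallNP h0; have /eqP := form_neq0 (sval Q); apply.
  by apply/mpolyP => mm; rewrite mcoeff0; have /negP := h0 mm; rewrite negbK => /eqP.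
move: ec; rewrite /= -map_lin_subst => ec.
have coefE m' : iota (lin_subst B (sval R))@_m' = c * iota (form_poly (sval Q))@_m'.
  by rewrite -mcoeff_map_mpoly ec mcoeffZ mcoeff_map_mpoly.
(* The scalar [c] belongs to k, being a quotient of coefficients of two polynomials over k. *)
pose c' := (lin_subst B (sval R))@_mm / (form_poly (sval Q))@_mm.
have c'E : iota c' = c by rewrite fmorph_div coefE mulfK // fmorph_eq0.
exists (PGL_of B), B; split=> //; exists c'; rewrite -(fmorph_eq0 iota) c'E c0; split=> //.
apply/mpolyP => m'; apply: (fmorph_inj iota).
by rewrite coefE mcoeffZ rmorphM c'E.
Qed.

(** With P(AX) = Q exactly and Q defined over k, also P(s(A)X) = Q; so A s(A)^-1 fixes P itself and
    lies in W. *)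
Lemma theta_lifts (e : Etilde iota n_gt0 m_gt2) :
  exists w : H1 (W iota n m_gt2), theta e = p_star n_gt0 w.
Proof.
rewrite -(repK e); set Q := rep e; have [g hg] := svalP Q.
have [A [Ag eA]] := fermat_morph_normal hg.
pose w (s : G) : GL K n := (A * (GLact s A)^-1)%g.
have w_mem s : in_wreath m (w s).
  apply: in_wreath_of_stabilizer; rewrite /w /= -lin_substM eA.
  have /(congr1 (map_mpoly s)) := eA; rewrite map_lin_subst.
  have := congr1 (@form_poly _ _ _) (base_change_gal s (sval Q)); rewrite /= => ->.
  have := congr1 (@form_poly _ _ _) (base_change_fermat n_gt0 m_gt2 s); rewrite /= => -> <-.
  have uA : map_mx s A \in unitmx by rewrite map_unitmx GL_unit.
  by rewrite lin_substM mulmxV // lin_subst1.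
have w_cont : krull_continuous w.
  apply: krull_continuousP => s; exists [seq A p.1 p.2 | p : 'I_n * 'I_n] => t ts.
  congr (_ * _^-1)%g; apply: val_inj; apply/matrixP => i j; rewrite /= !mxE.
  by apply: ts; apply/imageP; exists (i, j).
have wM s t : w (s * t)%g = (w s * GLact s (w t))%g.
  rewrite /w GLact_mul GLactM !mulgA mulgVK; congr (_ * _)%g.
  apply: (@mulgI _ (GLact s (GLact t A))); rewrite mulgV -GLact_mul mulgV.
  by apply: val_inj; rewrite /= map_mx1.
exists (cls (@cohomologous _ _ _ _) (@MkCocycle _ _ _ (W iota n m_gt2) w w_mem w_cont wM)).
rewrite (thetaE hg) /p_star H1_mapE; apply/cls_eq; first exact: cohomologous_equiv.
exists 1%g; split=> [|s] /=; first exact: form_morph1.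
by rewrite PGLact_1 invg1 mul1g mulg1 PGL_ofM PGL_ofV -PGLactE Ag PGLact_inv.
Qed.

Lemma theta_base : theta (Etilde_base iota n_gt0 m_gt2) = H1_base (Atilde iota n_gt0 m_gt2).
Proof.
have h1 : fermat_morph (base_change iota (sval (pform_fermat iota n_gt0 m_gt2))) P 1%g.
  by rewrite /= base_change_fermat; exact: form_morph1.
rewrite /Etilde_base (thetaE h1); apply/cls_eq; first exact: cohomologous_equiv.
exists 1%g; split=> [|s] /=; first exact: form_morph1.
by rewrite invg1 !PGLact_1 !mulg1.
Qed.

End Forms.

(** * Etale algebras, their homomorphisms and trace forms *)

Section EtaleHoms.
Variables (k K : fieldType) (iota : {rmorphism k -> K}) (n : nat).
Hypothesis sep_K : separable_closure iota.
Local Notation G := (gal iota).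

Lemma etale_basis (L : etale k n) : exists e : n.-tuple L, basis_of fullv e.
Proof.
exists (tcast (etale_dim L) (vbasis fullv)); rewrite val_tcast; exact: vbasisP.
Qed.

Lemma etale_homs (L : etale k n) : exists nu : 'I_n -> hom_k iota L, bijective nu.
Proof. by have := separable_homs sep_K (etale_sep L); rewrite etale_dim. Qed.

(** The coordinates of an element are recovered from its images by inverting [hom_mx]. *)
Lemma homs_separate (L : falgType k) (nu : 'I_n -> hom_k iota L) (e : n.-tuple L) x y :
  injective nu -> basis_of fullv e -> (forall i, nu i x = nu i y) -> x = y.
Proof.
move=> nu_inj he xy; rewrite (coord_basis he (memvf x)) (coord_basis he (memvf y)).
apply: eq_bigr => j _; congr (_ *: _); apply: (fmorph_inj iota).
pose c z : 'cV[K]_n := \col_j iota (coord e j z).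
have Hc z : hom_mx nu e *m c z = \col_i nu i z.
  apply/colP => i; rewrite !mxE [in RHS](coord_basis he (memvf z)) rmorph_sum.
  by apply: eq_bigr => l _; rewrite !mxE hom_linear mulrC.
have : c x = c y.
  apply: (can_inj (mulKmx (hom_mx_unit nu_inj he))); rewrite !Hc.
  by apply/colP => i; rewrite !mxE.
by move/colP/(_ j); rewrite !mxE.
Qed.

(* Galois descent for L: the image of L in K^N is the set of equivariant families. *)
Lemma equivariant_elt (L : etale k n) (nu : 'I_n -> hom_k iota L) (v : 'I_n -> K) :
  bijective nu ->
  (forall (s : G) i j, nu j = hom_act s (nu i) -> v j = s (v i)) ->
  exists y, forall i, nu i y = v i.
Proof.
move=> nu_bij vG; have [e he] := etale_basis L.
have H_unit := hom_mx_unit (bij_inj nu_bij) he; set H := hom_mx nu e in H_unit.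
pose c := invmx H *m \col_i v i.
have Hc : H *m c = \col_i v i by rewrite mulKVmx.
have [|c0 c0E] := gal_fixed_mx sep_K (A := c).
  move=> s; have [sg sgP] := hom_perm_ex s nu_bij.
  apply: (can_inj (mulKmx H_unit)); rewrite Hc; apply/colP => i.
  rewrite -[i](permKV sg); set i' := (sg^-1)%g i; rewrite [RHS]mxE.
  rewrite (vG s i' (sg i')); last exact: sgP.
  have /colP/(_ i') := Hc; rewrite [RHS]mxE => <-; rewrite !mxE rmorph_sum.
  by apply: eq_bigr => j _; rewrite !mxE rmorphM sgP.
exists (\sum_j c0 j 0 *: e`_j) => i; have /colP/(_ i) := Hc; rewrite c0E !mxE => <-.
by rewrite rmorph_sum; apply: eq_bigr => j _; rewrite !mxE hom_linear mulrC.
Qed.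

(** The hypothesis says that [tau] is an isomorphism of Galois sets; the images of [y] reindexed by
    [tau] then form an equivariant family, which comes from an element of L'. *)
Lemma equivariant_iso (L L' : etale k n) (nu : 'I_n -> hom_k iota L)
    (nu' : 'I_n -> hom_k iota L') (tau : 'S_n) :
  bijective nu -> bijective nu' ->
  (forall (s : G) i j, nu' j = hom_act s (nu' i) <-> nu (tau j) = hom_act s (nu (tau i))) ->
  exists psi : {lrmorphism L -> L'}, bijective psi /\ forall j y, nu' j (psi y) = nu (tau j) y.
Proof.
move=> nu_bij nu'_bij tauG; have [e he] := etale_basis L; have [e' he'] := etale_basis L'.
have sepL := homs_separate (bij_inj nu_bij) he.
have sepL' := homs_separate (bij_inj nu'_bij) he'.
have fP y : exists z, forall j, nu' j z = nu (tau j) y.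
  by apply: (equivariant_elt nu'_bij) => s i j /tauG ->.
have gP z : exists y, forall i, nu i y = nu' ((tau^-1)%g i) z.
  apply: (equivariant_elt nu_bij) => s i j.
  rewrite -{1}(permKV tau i) -{1}(permKV tau j) => /tauG -> //.
pose f y := sval (cid (fP y)).
have fE j y : nu' j (f y) = nu (tau j) y by exact: (svalP (cid (fP y))).
have f_add : zmod_morphism f by move=> y z; apply: sepL' => j; rewrite rmorphB !fE rmorphB.
have f_mon : monoid_morphism f.
  by split=> [|y z]; apply: sepL' => j; rewrite ?rmorphM !fE ?rmorphM ?rmorph1.
have f_scal : scalable f by move=> a y; apply: sepL' => j; rewrite fE !hom_linear fE.
pose fA := GRing.isZmodMorphism.Build _ _ f f_add.
pose fM := GRing.isMonoidMorphism.Build _ _ f f_mon.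
pose fS := GRing.isScalable.Build _ _ _ _ f f_scal.
pose fL : {lrmorphism L -> L'} := HB.pack f fA fM fS.
exists fL; split=> //; exists (fun z => sval (cid (gP z))) => [y|z].
  by apply: sepL => i; rewrite (svalP (cid (gP _))) fE permKV.
by apply: sepL' => j; rewrite fE (svalP (cid (gP _))) permK.
Qed.

End EtaleHoms.

(** * Splitting the cocycle of a pair, and the trace form over K *)

Section Pairs.
Variables (k K : fieldType) (iota : {rmorphism k -> K}) (n m : nat).
Hypothesis m_gt2 : (2 < m)%N.
Local Notation G := (gal iota).
Local Notation etpair := (etpair k n).

Lemma wreath_mx_inj mu mu' (sg sg' : 'S_n) : (forall i, mu i != 0) ->
  wreath_mx mu sg = wreath_mx mu' sg' :> 'M[K]_n -> sg = sg' /\ mu =1 mu'.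
Proof.
move=> mu0 /matrixP e; have sgE : sg = sg'.
  apply/permP => j; have := e (sg j) j; rewrite !mxE eqxx mulr1; case: eqP => // _ h.
  by have := mu0 (sg j); rewrite h mulr0 eqxx.
by split=> // i; have := e i ((sg^-1)%g i); rewrite !mxE -sgE permKV eqxx !mulr1.
Qed.

Section Split.
Variables (p : etpair) (e : n.-tuple (ep_alg p)).
Variables (nu : 'I_n -> hom_k iota (ep_alg p)) (r : hom_k iota (ep_alg p) -> K).
Hypotheses (he : basis_of fullv e) (nu_bij : bijective nu).
Hypothesis rP : forall phi, r phi ^+ m = phi (ep_elt p).

(** A matrix A with a_s s(A) = A for the cocycle a of the pair; the m-th powers of the linear forms
    given by its rows add up to the trace form. *)
Definition split_mx : 'M[K]_n := \matrix_(i, j) (nu i e`_j / r (nu i)).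

Lemma split_mx_unit : split_mx \in unitmx.
Proof.
have -> : split_mx = diag_mx (\row_i (r (nu i))^-1) *m hom_mx nu e.
  by apply/matrixP => i j; rewrite mul_diag_mx !mxE mulrC.
rewrite unitmx_mul hom_mx_unit ?andbT //; last exact: bij_inj.
rewrite unitmxE det_diag unitfE; apply/prodf_neq0 => i _.
by rewrite mxE invr_eq0 (pair_root_neq0 m_gt2 rP).
Qed.

Lemma split_mx_inv (s : G) (sg : 'S_n) :
  (forall j, nu (sg j) = hom_act s (nu j)) ->
  wreath_mx (fun i => s (r (hom_act (s^-1)%g (nu i))) / r (nu i)) sg *m map_mx s split_mx
    = split_mx.
Proof.
move=> sgP; apply/matrixP => i j; rewrite !mxE -(permKV sg i); set i' := (sg^-1)%g i.
rewrite (bigD1 i') //= big1 ?addr0 => [|l li]; last first.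
  by rewrite !mxE (inj_eq perm_inj) eq_sym (negPf li) mulr0 mul0r.
rewrite !mxE eqxx mulr1 sgP hom_actK fmorph_div /=.
have sr0 : s (r (nu i')) != 0 by rewrite fmorph_eq0 (pair_root_neq0 m_gt2 rP).
by rewrite mulrC mulrA divfK.
Qed.

End Split.

(** Conjugation by [hom_mx] diagonalises multiplication by [x], with eigenvalues [nu i x]. *)
Lemma trace_homs (L : etale k n) (e : n.-tuple L) (nu : 'I_n -> hom_k iota L) x :
  basis_of fullv e -> injective nu ->
  \sum_i iota (coord e i (x * e`_i)) = \sum_i nu i x.
Proof.
move=> he nu_inj; have H_unit := hom_mx_unit nu_inj he; set H := hom_mx nu e in H_unit.
pose T : 'M[K]_n := \matrix_(i, j) iota (coord e i (x * e`_j)).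
pose D : 'M[K]_n := diag_mx (\row_i nu i x).
have DT : T = invmx H *m (D *m H).
  rewrite (_ : D *m H = H *m T) ?mulKmx //; apply/matrixP => i j.
  rewrite mul_diag_mx !mxE -rmorphM [in LHS](coord_basis he (memvf (x * e`_j))) rmorph_sum.
  by apply: eq_bigr => l _; rewrite !mxE hom_linear mulrC.
transitivity (\tr T); first by apply: eq_bigr => i _; rewrite mxE.
rewrite DT mxtrace_mulC -mulmxA mulmxV // mulmx1 mxtrace_diag.
by apply: eq_bigr => i _; rewrite mxE.
Qed.

Lemma map_poly_trace (L : etale k n) (e : n.-tuple L) (nu : 'I_n -> hom_k iota L) f :
  basis_of fullv e -> injective nu ->
  map_mpoly iota (poly_trace e f) = \sum_i map_mpoly (nu i) f.
Proof.
move=> he nu_inj; apply/mpolyP => mm; rewrite mcoeff_map_mpoly [RHS]raddf_sum /=.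
under [RHS]eq_bigr => i _ do rewrite mcoeff_map_mpoly.
rewrite -(trace_homs f@_mm he nu_inj) /poly_trace /mxtrace raddf_sum rmorph_sum /=.
apply: eq_bigr => i _; rewrite mxE.
have addc : zmod_morphism (fun a => coord e i (a * e`_i)).
  by move=> a b; rewrite mulrBl linearB.
pose cA := GRing.isZmodMorphism.Build _ _ (fun a => coord e i (a * e`_i)) addc.
pose c : {additive L -> k} := HB.pack (fun a => coord e i (a * e`_i)) cA.
by rewrite (mcoeff_map_mpoly c).
Qed.

(** Over K the trace is the sum over all embeddings, and the factor 1/phi(x) = r(phi)^-m moves
    inside the m-th power. *)
Lemma map_trace_form (p : etpair) (e : n.-tuple (ep_alg p))
    (nu : 'I_n -> hom_k iota (ep_alg p)) (r : hom_k iota (ep_alg p) -> K) :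
  basis_of fullv e -> bijective nu -> (forall phi, r phi ^+ m = phi (ep_elt p)) ->
  map_mpoly iota (trace_form m e (ep_elt p)) = lin_subst (split_mx e nu r) (fermat_poly K n m).
Proof.
move=> he nu_bij rP; rewrite (map_poly_trace _ he (bij_inj nu_bij)) lin_subst_fermat.
apply: eq_bigr => i _; rewrite map_mpolyZ rmorphXn /= raddf_sum /=.
rewrite rmorphV ?ep_unit // -rP -exprVn -exprZn; congr (_ ^+ _); rewrite scaler_sumr.
by apply: eq_bigr => j _; rewrite map_mpolyZ map_mpolyX scalerA mxE mulrC.
Qed.

End Pairs.

(** * Cohomology classes of pairs (L, x) *)

Section PairClasses.
Variables (k K : fieldType) (iota : {rmorphism k -> K}) (n m : nat).
Variables (n_gt0 : (0 < n)%N) (m_gt2 : (2 < m)%N).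
Hypothesis char_k : forall p : nat, p \in [pchar k] -> ~~ (p %| m`!)%N.
Hypothesis sep_K : separable_closure iota.
Local Notation G := (gal iota).
Local Notation P := (fermat K n_gt0 m_gt2).
Local Notation etpair := (etpair k n).
Local Notation pair_cocycle := (@pair_cocycle k K iota n m m_gt2).
Local Notation pair_class := (@pair_class k K iota n m m_gt2).
Local Notation p_star := (@p_star k K iota n m n_gt0 m_gt2).
Local Notation cohomologous := (@cohomologous k K iota _).

Lemma pair_cocycle_split (p : etpair) a : pair_cocycle p a ->
  exists A : GL K n, forall s, (a s * GLact s A)%g = A.
Proof.
move=> [nu [r [nu_bij rP aP]]]; have [e he] := etale_basis (ep_alg p).
exists (MkGL (split_mx_unit m_gt2 he nu_bij rP)) => s; have [sg [sgP eq_a]] := aP s.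
by apply: val_inj; rewrite /= eq_a (split_mx_inv m_gt2).
Qed.

(** The splitting matrix of the cocycle is itself an isomorphism from the trace form to P, so both
    constructions give A s(A)^-1. Nonvanishing and homogeneity are checked over K. *)
Lemma theta_trace_form (p : etpair) (e : n.-tuple (ep_alg p)) : basis_of fullv e ->
  exists Q : pform iota n_gt0 m_gt2, form_poly (sval Q) = trace_form m e (ep_elt p) /\
    theta (cls (@pform_iso k K iota n m n_gt0 m_gt2) Q) = p_star (pair_class p).
Proof.
move=> he; have [a pa] := pair_cocycle_ex sep_K m_gt2 char_k p.
have [nu [r [nu_bij rP aP]]] := pa.
have A_unit := split_mx_unit m_gt2 he nu_bij rP; set A := split_mx _ _ _ in A_unit.
have trE := map_trace_form he nu_bij rP; rewrite -/A in trE.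
have tr_neq0 : trace_form m e (ep_elt p) != 0.
  apply: contraNneq (fermat_neq0 K n_gt0 m_gt2) => tr0; move: trE; rewrite tr0 rmorph0.
  move/esym/(congr1 (lin_subst (invmx A))); rewrite lin_substM mulmxV // lin_subst1 => ->.
  by rewrite /lin_subst comp_mpoly0.
have tr_homog : trace_form m e (ep_elt p) \is m.-homog.
  have : map_mpoly iota (trace_form m e (ep_elt p)) \is m.-homog.
    rewrite trE lin_subst_fermat; apply: rpred_sum => i _.
    have := dhomogMn m (_ : lin_form A i \is [in K[n], 1.-homog]).
    rewrite mul1n; apply; apply: rpred_sum => j _; apply: rpredZ.
    by rewrite dhomogX /= mdeg1.
  move/dhomogP => h; apply/dhomogP => mm hm; apply: h.
  by rewrite (perm_mem (msupp_map_mpoly _ (fmorph_inj iota))).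
pose Q : form k n m := MkForm tr_neq0 tr_homog.
have hQ : form_morph (base_change iota Q) P (PGL_of (MkGL A_unit)).
  by exists (MkGL A_unit); split=> //; exists 1; rewrite oner_eq0 scale1r; split.
exists (exist _ Q (ex_intro _ _ hQ)); split=> //.
rewrite (thetaE (Q := exist _ Q (ex_intro _ _ hQ)) hQ) (pair_classE pa) /p_star H1_mapE.
apply/cls_eq; first exact: cohomologous_equiv.
exists 1%g; split=> [|s] /=; first exact: form_morph1.
rewrite PGLact_1 invg1 mul1g mulg1 PGLact_inv PGLactE -PGL_ofV -PGL_ofM; congr PGL_of.
apply: (canRL (mulgK _)); apply: val_inj; have [sg [sgP eq_a]] := aP s.
by rewrite /= eq_a (split_mx_inv m_gt2).
Qed.

Definition comp_hom (L L' : falgType k) (psi : {lrmorphism L -> L'}) (phi : hom_k iota L') :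
  hom_k iota L.
Proof.
exists (GRing.RMorphism.clone _ _ (phi \o psi) _) => c /=.
by rewrite linearZ rmorph1 (svalP phi).
Defined.

(** One cocycle serves both pairs: the numbering is transported by [psi] and the roots are divided
    by phi(y), which leaves the coefficients unchanged because the family phi(y) is equivariant. *)
Lemma pair_class_iso (p p' : etpair) (psi : {lrmorphism ep_alg p -> ep_alg p'}) y :
  bijective psi -> y \is a GRing.unit -> ep_elt p' = psi (ep_elt p) * y ^+ m ->
  pair_class p = pair_class p'.
Proof.
move=> psi_bij uy xy; have [psi' [psiK psi'K]] := lrmorph_inv psi_bij.
have [a' pa'] := pair_cocycle_ex sep_K m_gt2 char_k p'; rewrite (pair_classE pa').
apply: pair_classE; have [nu' [r' [[mu' nu'K mu'K] rP' aP']]] := pa'.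
have compK phi : comp_hom psi' (comp_hom psi phi) = phi.
  by apply: homP => z; rewrite /= psi'K.
have comp'K phi : comp_hom psi (comp_hom psi' phi) = phi.
  by apply: homP => z; rewrite /= psiK.
have y0 (phi : hom_k iota (ep_alg p')) : phi y != 0 by rewrite -unitfE rmorph_unit.
exists (fun i => comp_hom psi (nu' i)).
exists (fun phi => r' (comp_hom psi' phi) / comp_hom psi' phi y); split=> [|phi|s].
- exists (fun phi => mu' (comp_hom psi' phi)) => [i|phi]; first by rewrite compK nu'K.
  by rewrite mu'K comp'K.
- rewrite exprMn exprVn rP' xy rmorphM rmorphXn mulfK ?expf_neq0 //.
  by rewrite -[LHS]/(phi (psi' (psi _))) psiK.
have [sg [sgP eq_a]] := aP' s; exists sg; split=> [j|].
  by rewrite sgP; exact: homP.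
rewrite eq_a; apply: eq_wreath_mx => i; rewrite compK.
have -> : comp_hom psi' (hom_act (s^-1)%g (comp_hom psi (nu' i))) = hom_act (s^-1)%g (nu' i).
  by apply: homP => z; rewrite /= psi'K.
rewrite fmorph_div invfM invrK /= galVK mulrACA.
by rewrite mulVf ?mulr1.
Qed.

(** Write b = (beta, tau). Comparing b a'_s with a_s s(b) shows that tau is an isomorphism of Galois
    sets, which gives [psi], and that the quotients r'_j / (beta r)_(tau j) form an equivariant
    family, which gives [y]. Since beta^m = 1, y^m is x' / psi(x). *)
Lemma cohomologous_pairs (p p' : etpair) a a' :
  pair_cocycle p a -> pair_cocycle p' a' -> cohomologous a a' ->
  exists (psi : {lrmorphism ep_alg p -> ep_alg p'}) (y : ep_alg p'),
    [/\ bijective psi, y \is a GRing.unit & ep_elt p' = psi (ep_elt p) * y ^+ m].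
Proof.
move=> [nu [r [nu_bij rP aP]]] [nu' [r' [nu'_bij rP' aP']]] [b [[beta [tau [betam eb]]] hb]].
have r0 := pair_root_neq0 m_gt2 rP; have r0' := pair_root_neq0 m_gt2 rP'.
have beta0 i : beta i != 0 := root1_neq0 m_gt2 (betam i).
have key (s : G) : exists sg sg' : 'S_n,
    [/\ forall j, nu (sg j) = hom_act s (nu j), forall j, nu' (sg' j) = hom_act s (nu' j),
      forall j, tau (sg' j) = sg (tau j) &
      forall j, s (r' (nu' j) / (beta (tau j) * r (nu (tau j)))) =
        r' (nu' (sg' j)) / (beta (tau (sg' j)) * r (nu (tau (sg' j))))].
  have [sg [sgP eq_a]] := aP s; have [sg' [sgP' eq_a']] := aP' s.
  exists sg, sg'; have : (b * a' s = a s * Gact s b)%g by rewrite hb -mulgA mulVKg.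
  move/(congr1 (@GLmx K n)) => /=.
  rewrite eq_a eq_a' eb map_wreath_mx !wreath_mxM.
  have nsa i : s (r (hom_act (s^-1)%g (nu i))) / r (nu i) != 0.
    by rewrite mulf_neq0 ?invr_eq0 // fmorph_eq0.
  have sb0 i : s (beta i) != 0 by rewrite fmorph_eq0.
  move/esym/wreath_mx_inj => [i|/permP tsg coefE].
    by apply: mulf_neq0; [exact: nsa | exact: sb0].
  have {}tsg j : tau (sg' j) = sg (tau j) by have := tsg j; rewrite !permM.
  split=> // j; have := coefE (tau (sg' j)); rewrite permK sgP' hom_actK.
  rewrite tsg permK sgP hom_actK -sgP -sgP' -tsg /= => h.
  rewrite fmorph_div rmorphM; apply/eqP; rewrite eqr_div ?mulf_neq0 ?fmorph_eq0 //; apply/eqP.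
  have x1 := r0 (nu (tau (sg' j))); have x2 := r0' (nu' (sg' j)).
  transitivity (beta (tau (sg' j)) * (s (r' (nu' j)) / r' (nu' (sg' j))) *
    (r (nu (tau (sg' j))) * r' (nu' (sg' j)))); first by field.
  by rewrite -h; field.
have tauG (s : G) i j : nu' j = hom_act s (nu' i) <-> nu (tau j) = hom_act s (nu (tau i)).
  have [sg [sg' [sgP sgP' tsg _]]] := key s; rewrite -sgP -sgP' -tsg.
  split=> [/(bij_inj nu'_bij) -> //|/(bij_inj nu_bij)/perm_inj ->] //.
have [psi [psi_bij psiE]] := equivariant_iso sep_K nu_bij nu'_bij tauG.
have [|y yE] := equivariant_elt sep_K (nu := nu')
    (v := fun j => r' (nu' j) / (beta (tau j) * r (nu (tau j)))) nu'_bij.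
  move=> s i j; have [sg [sg' [sgP sgP' tsg ->]]] := key s.
  by rewrite -sgP' => /(bij_inj nu'_bij) ->.
have xy : ep_elt p' = psi (ep_elt p) * y ^+ m.
  have [e' he'] := etale_basis (ep_alg p').
  apply: (homs_separate (bij_inj nu'_bij) he') => j.
  rewrite rmorphM rmorphXn psiE yE exprMn exprVn exprMn betam mul1r -!rP -!rP'.
  by rewrite mulrC divfK // expf_neq0.
exists psi, y; split=> //.
(* The element [y] is a unit because y^m times the unit psi(x) is the unit x'. *)
rewrite -(@unitrX_pos _ _ m); last by case: (m) m_gt2.
have uz : psi (ep_elt p) \is a GRing.unit by rewrite rmorph_unit // ep_unit.
by rewrite -(unitrMr _ uz) -xy ep_unit.
Qed.

Lemma pair_class_eqP (p p' : etpair) : pair_class p = pair_class p' <->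
  exists (psi : {lrmorphism ep_alg p -> ep_alg p'}) (y : ep_alg p'),
    [/\ bijective psi, y \is a GRing.unit & ep_elt p' = psi (ep_elt p) * y ^+ m].
Proof.
split=> [|[psi [y [psi_bij uy xy]]]]; last exact: pair_class_iso psi_bij uy xy.
have [a pa] := pair_cocycle_ex sep_K m_gt2 char_k p.
have [a' pa'] := pair_cocycle_ex sep_K m_gt2 char_k p'.
rewrite (pair_classE pa) (pair_classE pa') => /cls_eq h.
by apply: cohomologous_pairs pa pa' (h _); exact: cohomologous_equiv.
Qed.

End PairClasses.

(** * Pairs with the same image under p_* *)

Section Scaling.
Variables (k K : fieldType) (iota : {rmorphism k -> K}) (n m : nat).
Variables (n_gt0 : (0 < n)%N) (m_gt2 : (2 < m)%N).
Hypothesis char_k : forall p : nat, p \in [pchar k] -> ~~ (p %| m`!)%N.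
Hypothesis sep_K : separable_closure iota.
Local Notation G := (gal iota).
Local Notation pair_cocycle := (@pair_cocycle k K iota n m m_gt2).
Local Notation pair_class := (@pair_class k K iota n m m_gt2).
Local Notation p_star := (@p_star k K iota n m n_gt0 m_gt2).

Lemma wreath_scale_root (w w' : GL K n) z : in_wreath m w -> in_wreath m w' ->
  GLmx w' = z *: GLmx w -> z ^+ m = 1.
Proof.
move=> [mu [sg [hmu ->]]] [mu' [sg' [hmu' ->]]].
have -> : z *: wreath_mx mu sg = wreath_mx (fun i => z * mu i) sg.
  by apply/matrixP => i j; rewrite !mxE mulrA.
move/wreath_mx_inj => [i|_ e]; first by apply: root1_neq0 (hmu' i).
by have := hmu' (Ordinal n_gt0); rewrite e exprMn hmu mulr1.
Qed.

(** The numbers d r(phi) are m-th roots of phi(lambda x), so the cocycle changes only by the scalar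
    s(d)/d, which is invisible in PGL(n, K). *)
Lemma scale_pair_cocycle (L : etale k n) (x : L) (ux : x \is a GRing.unit) a
    (lambda : k) (lambda0 : lambda != 0) (d : K) :
  pair_cocycle (EtPair ux) a -> d ^+ m = iota lambda ->
  exists a', pair_cocycle (EtPair (scale_unit lambda0 ux)) a' /\
    forall s : G, GLmx (a' s) = (s d / d) *: GLmx (a s).
Proof.
move=> [nu [r [nu_bij rP aP]]] dm.
have d0 : d != 0.
  apply: contra_neq lambda0 => d0; apply: (fmorph_inj iota).
  by rewrite -dm d0 expr0n rmorph0; case: (m) m_gt2.
have r0 phi : r phi != 0 := pair_root_neq0 m_gt2 rP phi.
pose p2 := EtPair (scale_unit lambda0 ux).
have rP' (phi : hom_k iota (ep_alg p2)) : (d * r phi) ^+ m = phi (ep_elt p2).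
  by rewrite exprMn dm rP /= hom_linear.
exists (@pair_cocycle_of _ _ iota n m m_gt2 p2 nu _ nu_bij rP').
split=> [|s]; first exact: pair_cocycle_ofP.
have [sg [sgP ->]] := aP s; apply/matrixP => i j; rewrite /= !mxE.
have -> : @pair_perm _ _ iota n p2 nu nu_bij s = sg.
  by apply/permP => l; apply: (bij_inj nu_bij); rewrite pair_permE sgP.
rewrite /pair_coef rmorphM mulrA; congr (_ * _); have := r0 (nu i) => r0i; field.
by rewrite r0i.
Qed.

Lemma p_star_scale_class (L : etale k n) (x : L) (ux : x \is a GRing.unit)
    (lambda : k) (lambda0 : lambda != 0) :
  p_star (pair_class (EtPair (scale_unit lambda0 ux))) = p_star (pair_class (EtPair ux)).
Proof.
have [|d dm] := @root_ex _ _ iota sep_K m m_gt2 char_k (iota lambda); first by rewrite fmorph_eq0.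
have d0 : d != 0.
  apply: contra_neq lambda0 => d0; apply: (fmorph_inj iota).
  by rewrite -dm d0 expr0n rmorph0; case: (m) m_gt2.
have [a pa] := pair_cocycle_ex sep_K m_gt2 char_k (EtPair ux).
have [a' [pa' eq_a']] := scale_pair_cocycle lambda0 pa dm.
rewrite (pair_classE pa) (pair_classE pa') /p_star !H1_mapE.
apply/cls_eq; first exact: cohomologous_equiv.
exists 1%g; split=> [|s] /=; first exact: form_morph1.
rewrite PGLact_1 invg1 mul1g mulg1; apply/PGL_ofP.
exists (s d / d)^-1; rewrite eq_a' scalerA mulVf ?scale1r; last first.
  by rewrite mulf_neq0 ?invr_eq0 ?fmorph_eq0.
by rewrite invr_eq0 mulf_neq0 ?invr_eq0 ?fmorph_eq0.
Qed.

(** Cohomologous images are related by some [b] in W, up to scalars. With both cocycles split in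
    GL(n, K), the matrix [D] is Galois-invariant up to scalars, and a nonzero entry [d] makes the
    scalar explicit: a'_s = (s(d)/d) b^-1 a_s s(b). *)
Lemma p_star_pair_classP (L L' : etale k n) (x : L) (x' : L')
    (ux : x \is a GRing.unit) (ux' : x' \is a GRing.unit) :
  p_star (pair_class (EtPair ux)) = p_star (pair_class (EtPair ux')) <->
  exists (lambda : k) (lambda0 : lambda != 0),
    pair_class (EtPair (scale_unit lambda0 ux)) = pair_class (EtPair ux').
Proof.
split=> [|[lambda [lambda0 <-]]]; last by rewrite p_star_scale_class.
have [a pa] := pair_cocycle_ex sep_K m_gt2 char_k (EtPair ux).
have [a' pa'] := pair_cocycle_ex sep_K m_gt2 char_k (EtPair ux').
have [A hA] := pair_cocycle_split pa; have [A' hA'] := pair_cocycle_split pa'.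
rewrite (pair_classE pa) (pair_classE pa') /p_star !H1_mapE.
move=> /cls_eq[|_ [/(fermat_autP n_gt0 m_gt2 char_k sep_K)[b [bW <-]] hb]].
  exact: cohomologous_equiv.
pose D : GL K n := (A'^-1 * b^-1 * A)%g.
have aE s : a s = (A * (GLact s A)^-1)%g by exact: (canRL (mulgK _) (hA s)).
have aE' s : a' s = (A' * (GLact s A')^-1)%g by exact: (canRL (mulgK _) (hA' s)).
have GLactV s (B : GL K n) : GLact (iota := iota) s (B^-1)%g = ((GLact s B)^-1)%g.
  apply: (@mulgI _ (GLact s B)); rewrite -GLact_mul !mulgV.
  by apply: val_inj; rewrite /= map_mx1.
have sDP (s : G) : PGL_of (GLact s D) = PGL_of D.
  have h : PGL_of (a' s) = ((PGL_of b)^-1 * PGL_of (a s) * PGL_of (GLact s b))%g.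
    by rewrite -PGLactE; exact: hb s.
  move: h; rewrite aE aE' /D !GLact_mul !GLactV !PGL_ofM !PGL_ofV !mulgA => h.
  apply: (@mulgI _ (PGL_of A')).
  by rewrite !mulgA h mulgK mulgVK mulgV mul1g.
have a'D (s : G) : a' s = (b^-1 * A * D^-1 * GLact s D * (GLact s A)^-1 * GLact s b)%g.
  rewrite aE' /D !GLact_mul !GLactV !invgM !invgK !mulgA.
  by rewrite !(mulgK, mulgVK, mulVg, mul1g).
clearbody D; have [i [j Dij]] := GL_entry_neq0 n_gt0 D; set d := D i j in Dij.
have sD (s : G) : GLmx (GLact s D) = (s d / d) *: GLmx D.
  have /PGL_ofP[c [c0 e]] := sDP s; have /matrixP/(_ i j) := e; rewrite !mxE -/d => ->.
  by rewrite mulfK.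
have a'E (s : G) : GLmx (a' s) = (s d / d) *: GLmx (b^-1 * a s * GLact s b)%g.
  rewrite a'D /= (sD s : map_mx s D = _) -!scalemxAr -!scalemxAl aE /= mulmxKV ?GL_unit //.
  by rewrite !mulmxA.
(* Both cocycles take values in W, so s(d)/d is an m-th root of unity and d^m is
   Galois-invariant. *)
have dm (s : G) : s (d ^+ m) = d ^+ m.
  have : (s d / d) ^+ m = 1.
    apply: wreath_scale_root (a'E s); last exact: (cocycle_mem a').
    apply: in_wreathM (Gmem_act (g := W iota n m_gt2) s bW).
    by apply: in_wreathM (cocycle_mem a s); exact: in_wreathV.
  by rewrite exprMn exprVn -rmorphXn => /divr1_eq.
have [lambda lE] := gal_fixed sep_K dm.
have lambda0 : lambda != 0 by rewrite -(fmorph_eq0 iota) -lE expf_neq0.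
have [a2 [pa2 a2E]] := scale_pair_cocycle lambda0 pa lE.
exists lambda, lambda0; rewrite (pair_classE pa2).
apply/cls_eq; first exact: cohomologous_equiv.
exists b; split=> // s; apply: val_inj; apply: etrans (a'E s) _; rewrite /= a2E.
by rewrite -scalemxAr -scalemxAl.
Qed.

Lemma pair_class_simP (L L' : etale k n) (x : L) (x' : L')
    (ux : x \is a GRing.unit) (ux' : x' \is a GRing.unit) :
  (exists (lambda : k) (lambda0 : lambda != 0),
    pair_class (EtPair (scale_unit lambda0 ux)) = pair_class (EtPair ux')) <->
  exists psi : {lrmorphism L -> L'}, bijective psi /\ sim_k m x' (psi x).
Proof.
split=> [[lambda [lambda0 e]]|].
  have [psi [y [psi_bij uy xy]]] : exists (psi : {lrmorphism L -> L'}) (y : L'),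
      [/\ bijective psi, y \is a GRing.unit & x' = (lambda *: psi x) * y ^+ m].
    have [psi [y [psi_bij uy xy]]] := (pair_class_eqP m_gt2 char_k sep_K _ _).1 e.
    by exists psi, y; split=> //; rewrite -linearZ.
  (* The relation expresses psi(x) through x', hence the inverses of lambda and y. *)
  exists psi; split=> //; exists lambda^-1, idfun, y^-1; split; rewrite ?invr_eq0 ?unitrV //.
    by exists id.
  rewrite [in RHS]xy /= -!scalerAl scalerA mulVf // scale1r -mulrA.
  by rewrite -exprMn_comm ?mulrV ?expr1n ?mulr1 //; exact: etale_comm.
move=> [psi [psi_bij [lambda [c [y [lambda0 c_bij uy e]]]]]].
(* The automorphism of L' in the relation is absorbed into the isomorphism by composing [psi] with
   its inverse. *)
have [c' [cK c'K]] := lrmorph_inv c_bij.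
have lV0 : lambda^-1 != 0 by rewrite invr_eq0.
exists lambda^-1, lV0; apply/(pair_class_eqP m_gt2 char_k sep_K).
exists (c' \o psi), (c' y^-1); split=> /=.
- by apply: bij_comp psi_bij; exists c.
- by rewrite rmorph_unit ?unitrV.
rewrite !linearZ /= e !linearZ !rmorphM /= cK scalerA mulfV // scale1r -mulrA -rmorphXn -rmorphM.
by rewrite -exprMn_comm ?mulrV ?expr1n ?rmorph1 ?mulr1 //; exact: etale_comm.
Qed.

Lemma p_star_etpair_simP (p p' : etpair k n) :
  p_star (pair_class p) = p_star (pair_class p') <-> etpair_sim m p p'.
Proof.
case: p p' => [L x ux] [L' x' ux'].
exact: iff_trans (p_star_pair_classP ux ux') (pair_class_simP ux ux').
Qed.

(** The homomorphisms from k^n are the n projections, fixed by the Galois group; with all roots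
    equal to 1 the cocycle is trivial. *)
Lemma pair_class_base : pair_class (etpair_base k n_gt0) = H1_base (W iota n m_gt2).
Proof.
apply: pair_classE.
have [mu mu_bij] := etale_homs sep_K (split_etale k n_gt0).
pose f (i : 'I_n) : {rmorphism split_etale k n_gt0 -> K} :=
  GRing.RMorphism.clone _ _ (iota \o (@split_proj k n n_gt0 i : _ -> k)) _.
have fk i c : f i c%:A = iota c by rewrite /= /split_proj !ffunE; exact: congr1 (mulr1 c).
pose nu i : hom_k iota (split_etale k n_gt0) := exist _ (f i) (fk i).
have nu_inj : injective nu.
  move=> i j /(congr1 (fun phi : hom_k iota (split_etale k n_gt0) =>
    phi ([ffun l => (l == i)%:R] : split_alg k n_gt0))).
  rewrite /= /split_proj !ffunE eqxx rmorph1 => /esym.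
  by case: eqP => [->//|_] /eqP; rewrite rmorph0 eq_sym oner_eq0.
exists nu, (fun=> 1); split=> [|phi|s]; first exact: bij_hom_of_inj mu_bij nu_inj.
  by rewrite expr1n /= rmorph1.
exists 1%g; split=> [j|]; first by rewrite perm1; apply: homP => u /=; rewrite gal_fix.
rewrite /= -wreath_mx1; apply: eq_wreath_mx => i.
by rewrite rmorph1 divr1.
Qed.

End Scaling.

(** * The etale algebra of a permutation cocycle *)

(** A subspace of maximal dimension inside [P] exhausts it, since any missing vector could be
    added. *)
Lemma vspace_of_pred (k : fieldType) (V : vectType k) (P : V -> Prop) :
  P 0 -> (forall c u v, P u -> P v -> P (c *: u + v)) ->
  exists U : {vspace V}, forall x, x \in U <-> P x.
Proof.
move=> P0 Plin; pose D d := `[< exists U : {vspace V}, (forall x, x \in U -> P x) /\ \dim U = d >].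
have exD : exists d, D d.
  by exists 0%N; apply/asboolP; exists 0%VS; rewrite dimv0; split=> // x; rewrite memv0 => /eqP ->.
have ubD d : D d -> (d <= \dim {:V})%N.
  by move=> /asboolP[U [_ <-]]; apply: dimvS; exact: subvf.
have [d /asboolP[U [UP dU]] maxd] := ex_maxnP exD ubD.
exists U => x; split=> [/UP //|Px]; apply: contraT => xU.
suff /maxd : D (\dim (U + <[x]>)%VS).
  rewrite -dU leqNgt => /negP[]; rewrite ltn_neqAle dimvS ?addvSl // andbT.
  apply: contra xU => /eqP e; have /eqP -> : U == (U + <[x]>)%VS by rewrite eqEdim addvSl e /=.
  exact: (subvP (addvSr U <[x]>)) _ (memv_line x).
apply/asboolP; exists (U + <[x]>)%VS; split=> // _ /memv_addP[u uU [_ /vlineP[c ->] ->]].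
by rewrite addrC; apply: Plin => //; exact: UP.
Qed.

Section FunAlg.
Variables (k : fieldType) (M : fieldExtType k) (n : nat) (n_gt0 : (0 < n)%N).

(* The argument n_gt0 makes the ring non-trivial, as its structure requires. *)
Definition fun_alg : Type := let _ := n_gt0 in {ffun 'I_n -> M}.
HB.instance Definition _ := Vector.copy fun_alg {ffun 'I_n -> M}.
HB.instance Definition _ := GRing.PzRing.copy fun_alg {ffun 'I_n -> M}.
Fact fun_alg_one_neq0 : 1 != 0 :> fun_alg.
Proof. exact: (@ffun1_nonzero 'I_n M (Ordinal n_gt0)). Qed.
HB.instance Definition _ :=
  GRing.PzSemiRing_isNonZero.Build fun_alg fun_alg_one_neq0.
Fact fun_alg_scaleAl (a : k) (u v : fun_alg) : a *: (u * v) = (a *: u) * v.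
Proof. by apply/ffunP=> i; rewrite !ffunE scalerAl. Qed.
HB.instance Definition _ :=
  GRing.Lmodule_isLalgebra.Build k fun_alg fun_alg_scaleAl.
Fact fun_alg_scaleAr (a : k) (u v : fun_alg) : a *: (u * v) = u * (a *: v).
Proof. by apply/ffunP=> i; rewrite !ffunE scalerAr. Qed.
HB.instance Definition _ :=
  GRing.Lalgebra_isAlgebra.Build k fun_alg fun_alg_scaleAr.
HB.instance Definition _ := Algebra_isFalgebra.Build k fun_alg.

Definition fun_alg_eval (u : fun_alg) : 'I_n -> M := u : {ffun 'I_n -> M}.

Lemma fun_algP (u v : fun_alg) : fun_alg_eval u =1 fun_alg_eval v -> u = v.
Proof. by move=> uv; apply/ffunP. Qed.
Lemma fun_alg_eval1 i : fun_alg_eval 1 i = 1.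
Proof. by rewrite /fun_alg_eval ffunE. Qed.
Lemma fun_alg_evalM u v i : fun_alg_eval (u * v) i = fun_alg_eval u i * fun_alg_eval v i.
Proof. by rewrite /fun_alg_eval ffunE. Qed.
Lemma fun_alg_eval_linear c u v i :
  fun_alg_eval (c *: u + v) i = c *: fun_alg_eval u i + fun_alg_eval v i.
Proof. by rewrite /fun_alg_eval !ffunE. Qed.

End FunAlg.

Section TwistedForm.
Variables (k K : fieldType) (iota : {rmorphism k -> K}) (n : nat) (n_gt0 : (0 < n)%N).
Hypothesis sep_K : separable_closure iota.
Local Notation G := (gal iota).
Variables (sg : G -> 'S_n) (S : seq K).
Hypothesis sgM : forall (s t : G) i, sg (s * t)%g i = sg s (sg t i).
Hypothesis sg_cont : forall t : G, {in S, forall x, t x = x} -> sg t = 1%g.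

Lemma sg1 i : sg 1%g i = i.
Proof. by rewrite sg_cont ?perm1. Qed.

Lemma sgK s i : sg (s^-1)%g (sg s i) = i.
Proof. by rewrite -sgM mulVg sg1. Qed.

Definition orbit_pred (i : 'I_n) : pred 'I_n := fun l => `[< exists s, sg s i = l >].
(** [choose] depends only on the orbit as a predicate, so this representative is constant on
    orbits. *)
Definition orbit_rep i := choose (orbit_pred i) i.

Lemma orbit_predxx i : orbit_pred i i.
Proof. by apply/asboolP; exists 1%g; rewrite sg1. Qed.

Lemma orbit_repP i : exists s, sg s (orbit_rep i) = i.
Proof.
have /asboolP[s sP] := chooseP (orbit_predxx i); exists (s^-1)%g.
by rewrite /orbit_rep -sP sgK.
Qed.

Lemma orbit_rep_sg s i : orbit_rep (sg s i) = orbit_rep i.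
Proof.
have eq_orb : orbit_pred (sg s i) =1 orbit_pred i.
  move=> l; apply/asboolP/asboolP => -[t <-]; first by exists (t * s)%g; rewrite sgM.
  by exists (t * s^-1)%g; rewrite sgM sgK.
rewrite /orbit_rep (eq_choose eq_orb); apply: choose_id; last exact: orbit_predxx.
by apply/asboolP; exists s.
Qed.

Lemma orbit_rep_id i : orbit_rep (orbit_rep i) = orbit_rep i.
Proof. by have [s sP] := orbit_repP i; rewrite -[in RHS]sP orbit_rep_sg. Qed.

(** Hilbert 90 for permutation matrices: the columns of [B] are a basis of K^n made of equivariant
    families. *)
Lemma perm_descent : exists2 B : 'M[K]_n, B \in unitmx &
  forall (s : G) i j, s (B i j) = B (sg s i) j.
Proof.
have [||t tS|B uB hB] := @hilbert90 _ _ _ sep_K n (fun s => wreath_mx (fun=> 1) (sg s)) S.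
- move=> s; suff /mulmx1_unit[] : wreath_mx (fun=> 1) (sg s) *m
    wreath_mx (fun=> 1) ((sg s)^-1)%g = 1%:M :> 'M[K]_n by [].
  by rewrite wreath_mxM mulVg -wreath_mx1; apply: eq_wreath_mx => i; rewrite mulr1.
- move=> s t; rewrite map_wreath_mx wreath_mxM.
  have -> : sg (s * t)%g = (sg t * sg s)%g by apply/permP => i; rewrite sgM permM.
  by apply: eq_wreath_mx => i; rewrite /= rmorph1 mulr1.
- by rewrite sg_cont // wreath_mx1.
exists B => // s i j; have /matrixP/(_ (sg s i) j) := hB s => <-.
rewrite mxE (bigD1 i) //= big1 ?addr0 => [|l li]; first by rewrite !mxE eqxx !mul1r.
by rewrite !mxE (inj_eq perm_inj) eq_sym (negPf li) mulr0 mul0r.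
Qed.

Section InSubext.
Variables (M : fieldExtType k) (j : hom_k iota M).
Hypothesis jS : {in S, forall x, exists a, j a = x}.

Lemma sg_trivial (t : G) : (forall a, t (j a) = j a) -> sg t = 1%g.
Proof. by move=> tj; apply: sg_cont => x /jS[a <-]. Qed.

(** An automorphism fixing M acts trivially on indices, hence fixes every [v i]. *)
Lemma equivariant_in_subext (v : 'I_n -> K) : (forall (s : G) i, s (v i) = v (sg s i)) ->
  exists f : fun_alg M n_gt0, forall i, j (fun_alg_eval f i) = v i.
Proof.
move=> vG; have fP i : exists a, v i = j a.
  by apply: (gal_fixed_over sep_K) => s /sg_trivial s1; rewrite vG s1 perm1.
exists [ffun i => sval (cid (fP i))] => i.
by rewrite /fun_alg_eval ffunE -(svalP (cid (fP i))).
Qed.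

Definition equivariant (f : fun_alg M n_gt0) : Prop :=
  forall (s : G) i, s (j (fun_alg_eval f i)) = j (fun_alg_eval f (sg s i)).

Lemma equivariant_aspace : exists U : {aspace fun_alg M n_gt0}, forall f, f \in U <-> equivariant f.
Proof.
have [U UP] : exists U : {vspace fun_alg M n_gt0}, forall f, f \in U <-> equivariant f.
  apply: vspace_of_pred => [s i|c f g hf hg s i].
    by rewrite /fun_alg_eval !ffunE rmorph0 rmorph0.
  by rewrite !fun_alg_eval_linear !rmorphD !hom_linear rmorphM gal_fix hf hg.
have U_alg : is_aspace U.
  rewrite /is_aspace has_algid1; last by apply/UP => s i; rewrite !fun_alg_eval1 !rmorph1.
  apply/prodvP => f g /UP hf /UP hg; apply/UP => s i.
  by rewrite !fun_alg_evalM !rmorphM hf hg.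
by exists (ASpace U_alg).
Qed.

(** This fixed field of the stabiliser of [l] is the factor of the twisted algebra belonging to the
    orbit of [l]. *)
Lemma stabilizer_field (l : 'I_n) : exists E : {subfield M},
  forall y, y \in E <-> forall s : G, sg s l = l -> s (j y) = j y.
Proof.
have [E EP] : exists E : {vspace M},
    forall y, y \in E <-> forall s : G, sg s l = l -> s (j y) = j y.
  apply: vspace_of_pred => [s _|c y z hy hz s sl]; first by rewrite !rmorph0.
  by rewrite !rmorphD !hom_linear rmorphM gal_fix hy ?hz.
have E_alg : is_aspace E.
  rewrite /is_aspace has_algid1; last by apply/EP => s _; rewrite !rmorph1.
  by apply/prodvP => y z /EP hy /EP hz; apply/EP => s sl; rewrite !rmorphM hy ?hz.
by exists (ASpace E_alg).
Qed.

Variable U : {aspace fun_alg M n_gt0}.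
Hypothesis UP : forall f, f \in U <-> equivariant f.

Lemma vsvalU1 : vsval (1 : subvs_of U) = 1.
Proof.
by apply/eqP; rewrite /= algid_eq1; apply/UP => s i; rewrite !fun_alg_eval1 !rmorph1.
Qed.

Lemma U_equiv (u : subvs_of U) : equivariant (vsval u).
Proof. by apply/UP; exact: subvsP. Qed.

Lemma fun_alg_eval_inj (u v : subvs_of U) :
  (forall i, j (fun_alg_eval (vsval u) i) = j (fun_alg_eval (vsval v) i)) -> u = v.
Proof. by move=> uv; apply: val_inj; apply: fun_algP => i; exact: (fmorph_inj j). Qed.

Lemma equivariant_comm : commutative (@GRing.mul (subvs_of U)).
Proof.
by move=> u v; apply: val_inj; apply: fun_algP => i; rewrite /= !fun_alg_evalM mulrC.
Qed.

Lemma equivariant_sum m' (c : 'I_m' -> k) (b : 'I_m' -> fun_alg M n_gt0) i :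
  j (fun_alg_eval (\sum_l c l *: b l) i) = \sum_l iota (c l) * j (fun_alg_eval (b l) i).
Proof.
rewrite /fun_alg_eval sum_ffunE rmorph_sum; apply: eq_bigr => l _.
by rewrite ffunE hom_linear.
Qed.

(** The columns of [B] form a k-basis: the coordinates in them of an equivariant family are
    Galois-invariant, hence in k. *)
Lemma equivariant_dim : \dim {:subvs_of U} = n.
Proof.
rewrite dimvf /dim /=.
have [B uB BG] := perm_descent.
have bP l : exists f : fun_alg M n_gt0, forall i, j (fun_alg_eval f i) = B i l.
  by apply: equivariant_in_subext => s i; exact: BG.
pose b l := sval (cid (bP l)).
have bE l i : j (fun_alg_eval (b l) i) = B i l by exact: (svalP (cid (bP l))).
have sumE c i : j (fun_alg_eval (\sum_l c l *: b l) i) = (B *m \col_l iota (c l)) i 0.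
  rewrite equivariant_sum mxE; apply: eq_bigr => l _.
  by rewrite bE mxE mulrC.
pose X := [tuple b l | l < n]; have nthX (l : 'I_n) : X`_l = b l.
  by rewrite -tnth_nth tnth_mktuple.
suff basis_X : basis_of U X by exact: vector.size_basis basis_X.
rewrite basisEfree; apply/and3P; split.
- apply/freeP => c c0 l; apply: (fmorph_inj iota); rewrite rmorph0.
  have : B *m \col_l iota (c l) = 0.
    apply/colP => i; rewrite -sumE [RHS]mxE; under eq_bigr => l' _ do rewrite -nthX.
    by rewrite c0 /fun_alg_eval ffunE rmorph0.
  move/(congr1 (mulmx (invmx B))); rewrite mulKmx // mulmx0 => /colP/(_ l).
  by rewrite !mxE.
- apply/span_subvP => _ /tnthP[l ->]; rewrite tnth_mktuple; apply/UP => s i.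
  by rewrite !bE BG.
have dimU : (\dim U <= n)%N; last by rewrite size_tuple.
have /dimvS : (U <= <<X>>)%VS; last first.
  by move=> h; apply: leq_trans h _; rewrite -[leqRHS](size_tuple X) dim_span.
apply/subvP => f /UP hf; pose c := invmx B *m \col_i j (fun_alg_eval f i).
have Bc : B *m c = \col_i j (fun_alg_eval f i) by rewrite mulKVmx.
have [s|c0 c0E] := gal_fixed_mx sep_K (A := c).
  apply: (can_inj (mulKmx uB)); rewrite Bc; apply/colP => i.
  rewrite -[i](permKV (sg s)); set i' := ((sg s)^-1)%g i; rewrite [RHS]mxE -hf.
  have /colP/(_ i') := Bc; rewrite [RHS]mxE => <-; rewrite !mxE rmorph_sum.
  by apply: eq_bigr => l _; rewrite !mxE rmorphM BG.
suff -> : f = \sum_l c0 l 0 *: b l.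
  by apply: memv_suml => l _; rewrite memvZ // -nthX memv_span // mem_nth // size_tuple.
apply: fun_algP => i; apply: (fmorph_inj j); rewrite sumE.
have /colP/(_ i) := Bc; rewrite [RHS]mxE => <-; congr (_ i 0); congr (_ *m _).
by rewrite c0E; apply/colP => l; rewrite !mxE.
Qed.

(** An equivariant family is determined by its values at orbit representatives, and these may be any
    elements of the fixed fields of their stabilisers; so the algebra is the product of those
    fields. *)
Lemma equivariant_separable : separable_algebra (subvs_of U).
Proof.
pose T := [pred i | orbit_rep i == i]; pose q (o : 'I_#|T|) : 'I_n := enum_val o.
have q_rep o : orbit_rep (q o) = q o by apply/eqP; exact: (enum_valP o).
have oP i : exists o, q o = orbit_rep i.
  have Ti : orbit_rep i \in T by rewrite inE orbit_rep_id.
  by exists (enum_rank_in Ti (orbit_rep i)); exact: enum_rankK_in.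
pose o i := sval (cid (oP i)).
have qo i : q (o i) = orbit_rep i by exact: (svalP (cid (oP i))).
have q_inj : injective q by exact: enum_val_inj.
have oq l : o (q l) = l by apply: q_inj; rewrite qo q_rep.
have o_sg s i : o (sg s i) = o i by apply: q_inj; rewrite !qo orbit_rep_sg.
pose E l := sval (cid (stabilizer_field (q l))).
have EP l y : y \in E l <-> forall s : G, sg s (q l) = q l -> s (j y) = j y.
  exact: (svalP (cid (stabilizer_field (q l)))).
have uE l (u : subvs_of U) : fun_alg_eval (vsval u) (q l) \in E l.
  by apply/EP => s sq; rewrite U_equiv sq.
pose pr l (u : subvs_of U) : subvs_of (E l) := vsproj (E l) (fun_alg_eval (vsval u) (q l)).
have prE l u : vsval (pr l u) = fun_alg_eval (vsval u) (q l) by rewrite vsprojK.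
have pr_lin l : linear (pr l).
  move=> c u v; apply: val_inj; rewrite /= prE !linearP /= fun_alg_eval_linear.
  by rewrite !prE.
have pr_mon l : monoid_morphism (pr l).
  split=> [|u v]; apply: val_inj; rewrite /= !prE; last by rewrite /= fun_alg_evalM.
  by rewrite vsvalU1 fun_alg_eval1 algid1.
pose prR l : {lrmorphism subvs_of U -> subvs_of (E l)} :=
  HB.pack (pr l) (GRing.isLinear.Build _ _ _ _ (pr l) (pr_lin l))
    (GRing.isMonoidMorphism.Build _ _ (pr l) (pr_mon l)).
exists #|T|, (fun l => subvs_of (E l) : fieldExtType k), prR; split=> [l|y].
  have jE (c : k) :
    (GRing.RMorphism.clone _ _ (j \o vsval) _ : {rmorphism subvs_of (E l) -> K}) c%:A = iota c.
    by rewrite /= algid1; exact: svalP j c.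
  apply: (@separable_subext _ _ iota sep_K (subvs_of (E l))).
  exact: (exist _ _ jE).
pose Y l := j (vsval (y l)).
have YP s l : sg s (q l) = q l -> s (Y l) = Y l by move=> sq; exact: (EP l _).1 (subvsP (y l)) s sq.
pose t i := sval (cid (orbit_repP i)).
have tP i : sg (t i) (q (o i)) = i by rewrite qo; exact: (svalP (cid (orbit_repP i))).
pose v i := t i (Y (o i)).
(* The value at an index does not depend on which automorphism carries the representative there,
   since [Y l] is fixed by the stabiliser. *)
have vE (s : G) l : s (Y l) = v (sg s (q l)).
  rewrite /v; set i := sg s (q l); have oi : o i = l by rewrite /i o_sg oq.
  rewrite oi; apply: (can_inj (galVK (t i))); rewrite galK -galM YP //.
  by rewrite sgM -/i; have := sgK (t i) (q (o i)); rewrite tP oi.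
have [s i|f fE] := equivariant_in_subext (v := v).
  by rewrite {1}/v -galM vE sgM tP.
have fU : f \in U by apply/UP => s i; rewrite !fE /v -galM vE sgM tP.
exists (Subvs fU); split=> [l|u' hu'].
  apply: val_inj; apply: (fmorph_inj j); rewrite /= prE fE -/(Y l).
  by rewrite -{1}(sg1 (q l)) -vE gal1.
apply: fun_alg_eval_inj => i; rewrite /= fE -{2}(tP i) -U_equiv /v; congr (t i _).
by rewrite -prE; congr (j (vsval _)); exact: esym (hu' _).
Qed.

End InSubext.

(** The algebra is that of equivariant families, and [nu i] is evaluation at [i]. *)
Lemma etale_of_perm : exists (L : etale k n) (nu : 'I_n -> hom_k iota L),
  bijective nu /\ forall s i, nu (sg s i) = hom_act s (nu i).
Proof.
have [M [j jS]] := finite_subext sep_K S.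
have [U UP] := equivariant_aspace j.
pose L : etale k n :=
  MkEtale (@equivariant_comm M U) (equivariant_dim jS UP) (equivariant_separable jS UP).
pose g i (u : L) : K := j (fun_alg_eval (vsval u) i).
have g_add i : zmod_morphism (g i).
  by move=> u v; rewrite /g /fun_alg_eval !ffunE rmorphB.
have g_mon i : monoid_morphism (g i).
  by split=> [|u v]; rewrite /g ?(vsvalU1 UP) ?fun_alg_eval1 /= ?fun_alg_evalM ?rmorphM ?rmorph1.
pose gR i : {rmorphism L -> K} := HB.pack (g i) (GRing.isZmodMorphism.Build _ _ (g i) (g_add i))
  (GRing.isMonoidMorphism.Build _ _ (g i) (g_mon i)).
have gk i c : gR i c%:A = iota c.
  rewrite /= /g -[RHS](svalP j); congr (j _).
  have -> : vsval (c%:A : L) = c *: vsval (1 : subvs_of U) by [].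
  rewrite (vsvalU1 UP).
  by rewrite /fun_alg_eval !ffunE.
pose nu i : hom_k iota L := exist _ (gR i) (gk i).
have nuE i u : nu i u = j (fun_alg_eval (vsval u) i) by [].
have [mu mu_bij] := etale_homs sep_K L.
exists L, nu; split; last first.
  by move=> s i; apply: homP => u; rewrite nuE -(U_equiv UP).
apply: bij_hom_of_inj mu_bij _ => i i' nu_ii'.
(* If [nu i] and [nu i'] coincided, the equivariant columns of [B] would agree at i and i', giving
   an invertible matrix two equal rows. *)
have [B uB BG] := perm_descent.
have Bii' l : B i l = B i' l.
  have [s r|f fE] := equivariant_in_subext jS (v := fun r => B r l); first exact: BG.
  have fU : f \in U by apply/UP => s r; rewrite !fE BG.
  by rewrite -!fE -!(nuE _ (Subvs fU : L)) nu_ii'.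
apply/eqP; apply: contraT => ii'; have := mulmxV uB.
move/matrixP => BV; have := BV i i; have := BV i' i; rewrite !mxE eqxx eq_sym (negPf ii').
by under eq_bigr => l _ do rewrite -Bii'; move=> -> /esym/eqP; rewrite oner_eq0.
Qed.

End TwistedForm.

(** * Every class in H^1(G, W) comes from a pair *)

Section Surjectivity.
Variables (k K : fieldType) (iota : {rmorphism k -> K}) (n m : nat).
Variables (n_gt0 : (0 < n)%N) (m_gt2 : (2 < m)%N).
Hypothesis sep_K : separable_closure iota.
Local Notation G := (gal iota).

(** The permutation part gives L. Entries u_i of a splitting matrix satisfy mu_s(s i) s(u_i) = u_(s
    i), so their m-th powers are equivariant; x is the family u_i^-m, with roots u_i^-1. *)
Lemma pair_class_surjective (w : H1 (W iota n m_gt2)) :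
  exists p : etpair k n, pair_class iota m_gt2 p = w.
Proof.
rewrite -(repK w); set a := rep w.
have a1 : a 1%g = 1%g.
  by apply: (@mulgI _ (a 1%g)); rewrite mulg1 -[in RHS](mulg1 1%g) cocycleM [Gact _ _]Gact1.
have [S aS] : exists S : seq K, forall t : G, {in S, forall x, t x = x} -> a t = 1%g.
  have [S SP] := cocycle_cont (c := a) (V := fun g => g = 1%g) a1.
  by exists S => t tS; apply: SP => x /tS.
have wP s : exists mu_sg : ('I_n -> K) * 'S_n,
    (forall i, mu_sg.1 i ^+ m = 1) /\ GLmx (a s) = wreath_mx mu_sg.1 mu_sg.2.
  by have [mu [sg musg]] := cocycle_mem a s; exists (mu, sg).
pose mu s := (sval (cid (wP s))).1; pose sg s := (sval (cid (wP s))).2.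
have mu_root s i : mu s i ^+ m = 1 by exact: (svalP (cid (wP s))).1.
have aE s : GLmx (a s) = wreath_mx (mu s) (sg s) by exact: (svalP (cid (wP s))).2.
have mu0 s i : mu s i != 0 := root1_neq0 m_gt2 (mu_root s i).
have sgM (s t : G) i : sg (s * t)%g i = sg s (sg t i).
  have /(congr1 (@GLmx K n)) := cocycleM a s t.
  rewrite /= !aE map_wreath_mx wreath_mxM => /wreath_mx_inj[i'|-> _] //.
  by rewrite permM.
have sg_cont (t : G) : {in S, forall x, t x = x} -> sg t = 1%g.
  move=> /aS at1; have := aE t; rewrite at1 /= -wreath_mx1 => /wreath_mx_inj[i|<- _] //.
  exact: oner_neq0.
have [A A_unit AE] : exists2 A : 'M[K]_n, A \in unitmx &
    forall (s : G) i l, mu s (sg s i) * s (A i l) = A (sg s i) l.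
  have [|s t|t tS|A A_unit hA] := @hilbert90 _ _ _ sep_K n (fun s => GLmx (a s)) S.
  - by move=> s; exact: GL_unit.
  - by rewrite cocycleM.
  - by rewrite aS.
  exists A => // s i l; have /matrixP/(_ (sg s i) l) := hA s => <-.
  rewrite aE mxE (bigD1 i) //= big1 ?addr0 => [|i' ii']; first by rewrite !mxE eqxx mulr1.
  by rewrite !mxE (inj_eq perm_inj) eq_sym (negPf ii') mulr0 mul0r.
have [L [nu [nu_bij nuG]]] := etale_of_perm n_gt0 sep_K sgM sg_cont.
have colP i : exists l, A i l != 0.
  apply: contrapT => /forallNP h; have /matrixP/(_ i i)/eqP := mulmxV A_unit.
  rewrite !mxE eqxx big1 ?(eq_sym _ 1) ?oner_eq0 // => l _.
  by have /negP := h l; rewrite negbK => /eqP ->; rewrite mul0r.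
(* The column is chosen at the orbit representative, so it is the same along an orbit and the
   entries [u i] transform into one another without vanishing. *)
pose rp := orbit_rep sg; pose c i := sval (cid (colP (rp i))).
have cG s i : c (sg s i) = c i by rewrite /c /rp (orbit_rep_sg sgM sg_cont).
pose u i := A i (c i).
have uG (s : G) i : mu s (sg s i) * s (u i) = u (sg s i) by rewrite /u AE cG.
have u0 i : u i != 0.
  have [s sP] := orbit_repP sgM sg_cont i; rewrite -sP -uG mulf_neq0 ?fmorph_eq0 //.
  rewrite /u /c /rp (orbit_rep_id sgM sg_cont); exact: (svalP (cid (colP _))).
have umG (s : G) i : s (u i ^+ m) = u (sg s i) ^+ m.
  by rewrite -uG exprMn mu_root mul1r rmorphXn.
have elt (v : 'I_n -> K) : (forall (s : G) i, s (v i) = v (sg s i)) ->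
    exists y, forall i, nu i y = v i.
  move=> vG; apply: (equivariant_elt sep_K nu_bij) => s i j.
  by rewrite -nuG => /(bij_inj nu_bij) ->.
have [s i|x xE] := elt (fun i => (u i ^+ m)^-1); first by rewrite fmorphV umG.
have [s i|y yE] := elt (fun i => u i ^+ m); first by rewrite umG.
have [e he] := etale_basis L.
have xy : x * y = 1.
  apply: (homs_separate (bij_inj nu_bij) he) => i.
  by rewrite rmorphM rmorph1 xE yE mulVf // expf_neq0.
have ux : x \is a GRing.unit by apply/unitrP; exists y; rewrite etale_comm xy.
exists (EtPair ux); apply: pair_classE.
have [nuV nuK nuVK] := nu_bij.
exists nu, (fun phi => (u (nuV phi))^-1); split=> // [phi|s].
  by rewrite -{2}(nuVK phi) /= xE exprVn.
exists (sg s); split=> //; rewrite aE; apply: eq_wreath_mx => i.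
rewrite -(permKV (sg s) i); set i' := ((sg s)^-1)%g i.
rewrite nuG hom_actK -nuG !nuK fmorphV invrK -uG mulrCA mulVf ?mulr1 //.
by rewrite fmorph_eq0.
Qed.

End Surjectivity.

Theorem theorem3p10 (m n : nat) (m_gt2 : (2 < m)%N) (n_gt0 : (0 < n)%N)
    (k K : fieldType) (iota : {rmorphism k -> K})
    (char_k : forall p : nat, p \in [pchar k] -> ~~ (p %| m`!)%N)
    (sep_K : separable_closure iota) :
  (* A~ = W / mu_m, through the canonical projection W -> PGL(n, K) *)
  [/\ (forall g : PGL K n,
        form_morph (fermat K n_gt0 m_gt2) (fermat K n_gt0 m_gt2) g <->
        exists w : GL K n, in_wreath m w /\ PGL_of w = g) /\
      (forall w : GL K n, in_wreath m w ->
        (PGL_of w = 1%g <-> exists z : K, z ^+ m = 1 /\ GLmx w = z%:M)),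
  (* (i) *)
      [/\ injective (@theta k K iota n m n_gt0 m_gt2),
          forall c : H1 (Atilde iota n_gt0 m_gt2),
            (exists e, theta e = c) <-> (exists w, p_star n_gt0 w = c)
        & theta (Etilde_base iota n_gt0 m_gt2) = H1_base (Atilde iota n_gt0 m_gt2)],
  (* (ii) *)
      (forall (L L' : etale k n) (x : L) (x' : L')
              (ux : x \is a GRing.unit) (ux' : x' \is a GRing.unit),
        (p_star n_gt0 (pair_class iota m_gt2 (EtPair ux)) =
         p_star n_gt0 (pair_class iota m_gt2 (EtPair ux')) <->
         exists (lambda : k) (lambda0 : lambda != 0),
           pair_class iota m_gt2 (EtPair (scale_unit lambda0 ux)) =
           pair_class iota m_gt2 (EtPair ux')) /\
        ((exists (lambda : k) (lambda0 : lambda != 0),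
           pair_class iota m_gt2 (EtPair (scale_unit lambda0 ux)) =
           pair_class iota m_gt2 (EtPair ux')) <->
         exists psi : {lrmorphism L -> L'}, bijective psi /\ sim_k m x' (psi x)))
  (* (iii) *)
    & exists (Theta : Etilde iota n_gt0 m_gt2 -> etcoprod k n m)
             (Psi : etcoprod k n m -> Etilde iota n_gt0 m_gt2),
        [/\ cancel Theta Psi /\ cancel Psi Theta,
            forall (e : Etilde iota n_gt0 m_gt2) (p : etpair k n),
              Theta e = cls (etpair_sim m) p <->
              theta e = p_star n_gt0 (pair_class iota m_gt2 p),
            Theta (Etilde_base iota n_gt0 m_gt2) =
              cls (etpair_sim m) (etpair_base k n_gt0)
          & forall (p : etpair k n) (e : n.-tuple (ep_alg p)),
              basis_of fullv e ->
              exists Q : pform iota n_gt0 m_gt2,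
                form_poly (sval Q) = trace_form m e (ep_elt p) /\
                Psi (cls (etpair_sim m) p) = cls (@pform_iso k K iota n m n_gt0 m_gt2) Q]].
Proof.
have lift (e : Etilde iota n_gt0 m_gt2) : exists p : etpair k n,
    theta e = p_star n_gt0 (pair_class iota m_gt2 p).
  have [w ->] := theta_lifts char_k sep_K e.
  by have [p <-] := pair_class_surjective n_gt0 sep_K w; exists p.
have realize (p : etpair k n) : exists e : Etilde iota n_gt0 m_gt2,
    theta e = p_star n_gt0 (pair_class iota m_gt2 p).
  have [e he] := etale_basis (ep_alg p).
  by have [Q [_ <-]] := theta_trace_form n_gt0 m_gt2 char_k sep_K he; eexists.
have theta_inj := @theta_injective _ _ iota _ _ n_gt0 m_gt2 sep_K.
have simP := p_star_etpair_simP n_gt0 m_gt2 char_k sep_K.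
have sim_equiv := etpair_sim_equiv k n m.
split.
- split=> [g|w]; [exact: fermat_autP char_k sep_K g | exact: wreath_scalarP].
- split=> // [c|]; last exact: theta_base.
  split=> [[e <-]|[w <-]]; first by have [w ->] := theta_lifts char_k sep_K e; exists w.
  by have [p <-] := pair_class_surjective n_gt0 sep_K w; exact: realize.
- by move=> L L' x x' ux ux'; split; [exact: p_star_pair_classP | exact: pair_class_simP].
(* The pair and the form are arbitrary choices with matching classes in H^1(G, A~); [simP] and the
   injectivity of theta make the results independent of them. *)
pose Theta e : etcoprod k n m := cls (etpair_sim m) (sval (cid (lift e))).
pose Psi (c : etcoprod k n m) := sval (cid (realize (rep c))).
have PsiE p : theta (Psi (cls (etpair_sim m) p)) = p_star n_gt0 (pair_class iota m_gt2 p).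
  rewrite /Psi; case: cid => e /= ->; apply/simP; exact: rep_cls.
have ThetaE e p : Theta e = cls (etpair_sim m) p <->
    theta e = p_star n_gt0 (pair_class iota m_gt2 p).
  rewrite /Theta; case: cid => q /= ->.
  exact: iff_trans (cls_eq sim_equiv q p) (iff_sym (simP q p)).
exists Theta, Psi; split=> //.
- split=> [e|c].
    apply: theta_inj; have [p ep] := lift e.
    by rewrite ((ThetaE e p).2 ep) PsiE.
  by rewrite -(repK c); apply/ThetaE; rewrite PsiE.
- apply/ThetaE; rewrite theta_base (pair_class_base n_gt0 m_gt2 sep_K) /p_star H1_mapE.
  apply/cls_eq; first exact: cohomologous_equiv.
  exists 1%g; split=> [|s] /=; first exact: form_morph1.
  by rewrite PGLact_1 invg1 !mulg1.
- move=> p e he; have [Q [QE thQ]] := theta_trace_form n_gt0 m_gt2 char_k sep_K he.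
  by exists Q; split=> //; apply: theta_inj; rewrite PsiE thQ.
Qed.
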